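(* Let $K\ge1$, $K'\ge0$, let $p\ge1$ be an integer, and let $F$ be a $(K,K')$-elliptic polyharmonic mapping in $\mathbb{D}$ of the form $$F(z)=a_0+\sum_{k=1}^p|z|^{2(k-1)}\sum_{n=1}^\infty\left(a_{n,k}z^n+\overline{b_{n,k}z^n}\right),$$ such that, for every $n\ge1$ and all $k_1,k_2,k_3,k_4\in\{1,\dots,p\}$, all non-zero coefficients $a_{n,k_1},a_{n,k_2}$ and $b_{n,k_3},b_{n,k_4}$ satisfy $$\left|\arg\frac{a_{n,k_1}}{a_{n,k_2}}\right|\le\frac{\pi}{2}\quad\text{and}\quad\left|\arg\frac{b_{n,k_3}}{b_{n,k_4}}\right|\le\frac{\pi}{2}.$$ Suppose $\lambda_F(z)\le\lambda$ for all $z\in\mathbb{D}$, where $\lambda$ is a constant. Then $$\sum_{k=1}^p\sum_{n=1}^\infty\left((n+k-1)^2+(k-1)^2\right)\left(|a_{n,k}|^2+|b_{n,k}|^2\right)\le\frac{(K^2+1)\lambda^2+2K\sqrt{K'}\lambda+K'}{2}.$$ In particular, $$|a_{n,k}|+|b_{n,k}|\le\frac{\sqrt{(K^2+1)\lambda^2+2K\sqrt{K'}\lambda+K'}}{n}\quad\text{for all } n\ge2,\ k=1,$$ $$|a_{n,k}|+|b_{n,k}|\le\frac{\sqrt{(K^2+1)\lambda^2+2K\sqrt{K'}\lambda+K'}}{\sqrt{10}}\quad\text{for all } n\ge2,\ 2\le k\le p,$$ $$|a_{n,k}|+|b_{n,k}|\le\frac{\sqrt{(K^2+1)\lambda^2+2K\sqrt{K'}\lambda+K'}}{\sqrt{5}}\quad\text{for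 } n=1,\ 2\le k\le p.$$
   Context: $\mathbb{D}=\{z\in\mathbb{C}:|z|<1\}$. For a continuously differentiable complex-valued $f$ put $\Lambda_f(z)=|f_z(z)|+|f_{\bar z}(z)|$, $\lambda_f(z)=\big||f_z(z)|-|f_{\bar z}(z)|\big|$, $J_f(z)=|f_z(z)|^2-|f_{\bar z}(z)|^2$. A $2p$-times continuously differentiable complex-valued $F$ is polyharmonic if $\Delta^pF=0$, where $\Delta=4\partial^2/\partial z\partial\bar z$. In $\mathbb{D}$ this is equivalent to $F(z)=\sum_{k=1}^p|z|^{2(k-1)}G_{p-k+1}(z)$ with all $G_{p-k+1}$ complex-valued harmonic in $\mathbb{D}$. In the series representation in the claim, for each $k$ the functions $\sum_{n\ge1}a_{n,k}z^n$ and $\sum_{n\ge1}b_{n,k}z^n$ are analytic in $\mathbb{D}$. A mapping $f$ is ACL in $\mathbb{D}$ if for every closed rectangle $R\subset\mathbb{D}$ with sides parallel to the axes, $f$ is absolutely continuous on almost every horizontal and almost every vertical line in $R$; $f\in ACL^2$ if moreover its partial derivatives are locally $L^2$ in $\mathbb{D}$. A sense-preserving continuous mapping $f:\mathbb{D}\to\mathbb{C}$ is $(K,K')$-elliptic ($K\ge1$, $K'\ge0$) if (1) $f$ is $ACL^2$ in $\mathbb{D}$ and $J_f\ne0$ a.e. in $\mathbb{D}$; and (2) $\Lambda_f^2\le KJ_f+K'$ a.e. in $\mathbb{D}$. (For a continuously differentiable $f$, which is automatically $ACL^2$, sense-preserving is taken to mean $J_f\ge0$, so that $J_f>0$ a.e.)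 $\arg$ denotes the principal argument, in $(-\pi,\pi]$. *)

(* Defs.v *)
From HB Require Import structures.
From mathcomp Require Import all_boot all_order all_algebra.
From mathcomp Require Import all_classical all_reals all_analysis.
From mathcomp Require Import complex.

Set Implicit Arguments.
Unset Strict Implicit.
Unset Printing Implicit Defensive.

Import Order.TTheory GRing.Theory Num.Theory.
Import numFieldNormedType.Exports.

Local Open Scope classical_set_scope.
Local Open Scope ring_scope.

(* R[i] carries no registered topology of its own; seen as an abstract
   numFieldType it gets the one given by its norm. *)
Definition cplx (R : realType) : numFieldType := R[i].

Section Planar.
Context {R : realType}.
Implicit Types (f g : cplx R -> cplx R) (z : cplx R).

(* The norm `|z| of cplx R is itself an element of cplx R; cabs z is in R. *)
Definition cabs z : R := Normc.normc z.

Definition unit_disk : set (cplx R) := [set z | cabs z < 1].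

Definition toC (q : R * R) : cplx R := Complex q.1 q.2.

(* Restrictions of f to the horizontal and vertical lines through z. *)
Definition horiz_slice f z : R -> cplx R := fun t => f (Complex t (complex.Im z)).
Definition vert_slice f z : R -> cplx R := fun t => f (Complex (complex.Re z) t).

Definition cderivable (h : R -> cplx R) (t : R) : Prop :=
  derivable (fun s => complex.Re (h s)) t 1 /\
  derivable (fun s => complex.Im (h s)) t 1.

Definition cderive (h : R -> cplx R) (t : R) : cplx R :=
  Complex (derive1 (fun s => complex.Re (h s)) t)
          (derive1 (fun s => complex.Im (h s)) t).

Definition pdx f z : cplx R := cderive (horiz_slice f z) (complex.Re z).
Definition pdy f z : cplx R := cderive (vert_slice f z) (complex.Im z).

(* f_z and f_{\bar z} *)
Definition dz f z : cplx R := (pdx f z - 'i%C * pdy f z) / 2.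
Definition dzbar f z : cplx R := (pdx f z + 'i%C * pdy f z) / 2.

Definition big_Lambda f z : R := cabs (dz f z) + cabs (dzbar f z).
Definition small_lambda f z : R := `|cabs (dz f z) - cabs (dzbar f z)|.
Definition Jdet f z : R := cabs (dz f z) ^+ 2 - cabs (dzbar f z) ^+ 2.

Definition continuous_on_disk f : Prop :=
  forall z, unit_disk z -> {for z, continuous f}.

(* m times continuously differentiable in the disk, in the real sense: all
   iterated partial derivatives of order at most m exist and are continuous. *)
Fixpoint Cm_on_disk (m : nat) f : Prop :=
  if m is m'.+1 then
    [/\ continuous_on_disk f,
        forall z, unit_disk z ->
          cderivable (horiz_slice f z) (complex.Re z) /\
          cderivable (vert_slice f z) (complex.Im z),
        Cm_on_disk m' (pdx f)
      & Cm_on_disk m' (pdy f)]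
  else continuous_on_disk f.

Definition laplacian f : cplx R -> cplx R := fun z => 4 * dz (dzbar f) z.

Definition polyharmonic (p : nat) f : Prop :=
  Cm_on_disk (2 * p)%N f /\
  forall z, unit_disk z -> iter p laplacian f z = 0.

(* Absolute continuity on [a, b]: the [s i, t i] below are finitely many
   nonoverlapping subintervals of [a, b]. *)
Definition abs_continuous_on (a b : R) (h : R -> cplx R) : Prop :=
  forall e : R, 0 < e -> exists2 d : R, 0 < d &
    forall (n : nat) (s t : 'I_n -> R),
      (forall i, [/\ a <= s i, s i <= t i & t i <= b]) ->
      (forall i j, i != j -> t i <= s j \/ t j <= s i) ->
      \sum_(i < n) (t i - s i) < d ->
      \sum_(i < n) cabs (h (t i) - h (s i)) < e.

Definition ACL f : Prop :=
  forall a b c d : R, a < b -> c < d ->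
    (forall x y : R, a <= x <= b -> c <= y <= d -> unit_disk (Complex x y)) ->
    {ae (@lebesgue_measure R), forall y : R, c <= y <= d ->
       abs_continuous_on a b (fun x => f (Complex x y))} /\
    {ae (@lebesgue_measure R), forall x : R, a <= x <= b ->
       abs_continuous_on c d (fun y => f (Complex x y))}.

Definition planar_measure := (@lebesgue_measure R \x @lebesgue_measure R)%E.

Definition locally_L2 g : Prop :=
  forall A : set (R * R), compact A -> A `<=` toC @^-1` unit_disk ->
    [/\ measurable_fun A (fun q => complex.Re (g (toC q))),
        measurable_fun A (fun q => complex.Im (g (toC q)))
      & (\int[planar_measure]_(q in A) (cabs (g (toC q)) ^+ 2)%:E < +oo)%E].

Definition ACL2 f : Prop := [/\ ACL f, locally_L2 (pdx f) & locally_L2 (pdy f)].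

(* Convention for continuously differentiable maps, the only ones to which
   it is applied. *)
Definition sense_preserving f : Prop :=
  forall z, unit_disk z -> 0 <= Jdet f z.

Definition ae_on_disk (P : cplx R -> Prop) : Prop :=
  {ae planar_measure, forall q : R * R, unit_disk (toC q) -> P (toC q)}.

Definition elliptic (K K' : R) f : Prop :=
  [/\ continuous_on_disk f,
      sense_preserving f,
      ACL2 f,
      ae_on_disk (fun z => Jdet f z != 0)
    & ae_on_disk (fun z => big_Lambda f z ^+ 2 <= K * Jdet f z + K')].

(* Principal argument in ]-pi, pi] of a nonzero z. *)
Definition arg z : R :=
  let t := acos (complex.Re z / cabs z) in
  if 0 <= complex.Im z then t else - t.

(* Convergence in the whole disk is what makes the sum of
   \sum_(n >= 1) c n z^n defined and analytic there. *)
Definition pseries1_analytic (c : nat -> cplx R) : Prop :=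
  forall z, unit_disk z ->
    cvgn (fun N : nat => \sum_(1 <= n < N) c n * z ^+ n).

(* a n k and b n k are the coefficients a_{n,k} and b_{n,k}; only the values
   at n >= 1 and 1 <= k <= p are used. *)
Definition has_series_form (p : nat) (a0 : cplx R) (a b : nat -> nat -> cplx R) f
    : Prop :=
  (forall k : nat, (1 <= k <= p)%N ->
     pseries1_analytic (a ^~ k) /\ pseries1_analytic (b ^~ k)) /\
  forall z, unit_disk z ->
    f z = a0 + \sum_(1 <= k < p.+1) `|z| ^+ (2 * (k - 1)) *
      limn (fun N : nat =>
        \sum_(1 <= n < N) (a n k * z ^+ n + ((b n k * z ^+ n)^*)%C)).

Definition args_within_right_angle (p : nat) (c : nat -> nat -> cplx R) : Prop :=
  forall n k1 k2 : nat, (1 <= n)%N -> (1 <= k1 <= p)%N -> (1 <= k2 <= p)%N ->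
    c n k1 != 0 -> c n k2 != 0 -> `|arg (c n k1 / c n k2)| <= pi / 2.

End Planar.

(* Main.v *)
(** On |z| = r the functions z F_z and zbar F_zbar have absolutely convergent
    Fourier series, whose coefficients are the sums over k of
    r^(n+2(k-1)) (n+k-1) a_{n,k} and r^(n+2(k-1)) (k-1) conj(b_{n,k}), and the
    same with a and b exchanged.  Parseval's identity, applied to partial sums
    and averaged over N-th roots of unity instead of the circle, turns a
    pointwise bound on |F_z|^2 + |F_zbar|^2 into a bound on the squared moduli
    of these coefficients; the condition on the arguments makes the cross terms
    of each coefficient nonnegative, so that only the diagonal remains, and r
    tends to 1.  The pointwise bound comes from J_F = Lambda_F lambda_F: the
    inequality Lambda^2 <= K Lambda lambda + K' gives
    Lambda <= K lambda + sqrt K', and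
    |F_z|^2 + |F_zbar|^2 = (Lambda^2 + lambda^2) / 2.  It holds everywhere and
    not just almost everywhere because F is of class C^1. *)
Require Import Defs.
From mathcomp Require Import all_boot all_order all_algebra.
From mathcomp Require Import all_classical all_reals all_analysis.
From mathcomp Require Import complex.
From mathcomp Require Import ring lra zify.
Import Order.TTheory GRing.Theory Num.Theory.
Import numFieldNormedType.Exports.
Local Open Scope classical_set_scope.
Local Open Scope ring_scope.

Set Implicit Arguments.
Unset Strict Implicit.

(** * Modulus and convergence in the complex plane *)

(* Stated over an abstract field: on [cplx R] the library lemmas send
   unification through the concrete structures on [R[i]]. *)
Section NumFieldSequences.
Variable K : numFieldType.
Implicit Types u v : nat -> K.

Lemma cvgn_cst (x : K) : (fun=> x : K) @ \oo --> x.
Proof. exact: cvg_cst. Qed.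

Lemma cvgnD u v (x y : K) :
  u @ \oo --> x -> v @ \oo --> y -> (fun n => u n + v n) @ \oo --> x + y.
Proof. exact: cvgD. Qed.

Lemma cvgnB u v (x y : K) :
  u @ \oo --> x -> v @ \oo --> y -> (fun n => u n - v n) @ \oo --> x - y.
Proof. exact: cvgB. Qed.

Lemma cvgnMr u (x y : K) : u @ \oo --> x -> (fun n => u n * y) @ \oo --> x * y.
Proof. by move=> ux; apply: cvgMl. Qed.

Lemma cvgn_lim u (x : K) : u @ \oo --> x -> limn u = x.
Proof. exact/cvg_lim/norm_hausdorff. Qed.

End NumFieldSequences.

Section ComplexModulus.
Variable R : realType.
Implicit Types z w : cplx R.

Lemma cabsE z : cabs z = Num.sqrt (complex.Re z ^+ 2 + complex.Im z ^+ 2).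
Proof. by case: z. Qed.

Lemma normr_cplx z : `|z| = (cabs z)%:C%C :> cplx R. Proof. by []. Qed.

Lemma cabsM z w : cabs (z * w) = cabs z * cabs w.
Proof. exact: Normc.normcM. Qed.

Lemma ler_cabsD z w : cabs (z + w) <= cabs z + cabs w.
Proof. exact: le_normcD. Qed.

Lemma cabs_ge0 z : 0 <= cabs z. Proof. by rewrite cabsE sqrtr_ge0. Qed.

Lemma cabs0 : cabs (0 : cplx R) = 0. Proof. exact: Normc.normc0. Qed.

Lemma cabs1 : cabs (1 : cplx R) = 1. Proof. exact: Normc.normc1. Qed.

Lemma cabsN z : cabs (- z) = cabs z. Proof. exact: normcN. Qed.

Lemma cabsB z w : cabs (z - w) = cabs (w - z).
Proof. by rewrite -cabsN opprB. Qed.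

Lemma cabsV z : cabs z^-1 = (cabs z)^-1. Proof. by apply: Normc.normcV. Qed.

Lemma cabsX z n : cabs (z ^+ n) = cabs z ^+ n.
Proof. by elim: n => [|n IH]; rewrite ?expr0 ?cabs1 // !exprS cabsM IH. Qed.

Lemma cabs_eq0 z : (cabs z == 0) = (z == 0).
Proof.
apply/eqP/eqP => [|->]; last exact: cabs0.
exact: Normc.eq0_normc.
Qed.

Lemma cabs_real (x : R) : cabs (x%:C%C : cplx R) = `|x|.
Proof. by rewrite cabsE /= expr0n /= addr0 sqrtr_sqr. Qed.

Lemma cabs_nat n : cabs (n%:R : cplx R) = n%:R.
Proof.
have -> : n%:R = (n%:R)%:C%C :> cplx R by exact/esym/(rmorph_nat (real_complex R) n).
by rewrite cabs_real ger0_norm.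
Qed.

Lemma cabs_conj z : cabs (z^*)%C = cabs z.
Proof. by case: z => x y; rewrite !cabsE /= sqrrN. Qed.

Lemma conj0 : ((0 : cplx R)^*)%C = 0 :> cplx R. Proof. exact: conjc0. Qed.

Lemma conj_real (x : R) : ((x%:C : cplx R)^*)%C = x%:C%C :> cplx R.
Proof. exact: conjc_real. Qed.

Lemma conjD z w : ((z + w)^*)%C = (z^*)%C + (w^*)%C :> cplx R.
Proof. exact: (rmorphD conjc). Qed.

Lemma conjM z w : ((z * w)^*)%C = (z^*)%C * (w^*)%C :> cplx R.
Proof. exact: (rmorphM conjc). Qed.

Lemma conjX z n : ((z ^+ n)^*)%C = (z^*)%C ^+ n :> cplx R.
Proof. exact: (rmorphXn conjc n z). Qed.

Lemma conj_sum (I : Type) (s : seq I) (f : I -> cplx R) :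
  ((\sum_(i <- s) f i)^*)%C = \sum_(i <- s) ((f i)^*)%C :> cplx R.
Proof. exact: (raddf_sum conjc). Qed.

Lemma cabs_sum (I : Type) (s : seq I) (P : pred I) (f : I -> cplx R) :
  cabs (\sum_(i <- s | P i) f i) <= \sum_(i <- s | P i) cabs (f i).
Proof.
elim/big_ind2 : _ => [|x1 x2 y1 y2 h1 h2|//]; first by rewrite cabs0.
exact: (le_trans (ler_cabsD _ _) (lerD h1 h2)).
Qed.

Lemma ler_cabs_dist z w : `|cabs z - cabs w| <= cabs (z - w).
Proof.
have h1 := ler_cabsD (z - w) w; have h2 := ler_cabsD (w - z) z.
rewrite !subrK in h1 h2; rewrite (cabsB w z) in h2.
by rewrite ler_norml; apply/andP; split; lra.
Qed.

Lemma sqr_cabs z : ((cabs z) ^+ 2)%:C%C = z * (z^*)%C :> cplx R.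
Proof.
case: z => x y; rewrite cabsE sqr_sqrtr ?addr_ge0 ?sqr_ge0 //=.
by apply/eqP; rewrite eq_complex /=; apply/andP; split; apply/eqP; ring.
Qed.

Lemma sqr_cabs_Re z : cabs z ^+ 2 = complex.Re z ^+ 2 + complex.Im z ^+ 2.
Proof. by rewrite cabsE sqr_sqrtr // addr_ge0 ?sqr_ge0. Qed.

Lemma normr_Re_le_cabs z : `|complex.Re z| <= cabs z.
Proof.
rewrite cabsE -[X in X <= _]sqrtr_sqr ler_wsqrtr // lerDl; exact: sqr_ge0.
Qed.

Lemma normr_Im_le_cabs z : `|complex.Im z| <= cabs z.
Proof.
rewrite cabsE -[X in X <= _]sqrtr_sqr ler_wsqrtr // lerDr; exact: sqr_ge0.
Qed.

Lemma cabs_le_ReIm z : cabs z <= `|complex.Re z| + `|complex.Im z|.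
Proof.
rewrite -(@ler_pXn2r _ 2) ?nnegrE ?cabs_ge0 ?addr_ge0 //.
rewrite sqr_cabs_Re sqrrD !real_normK ?num_real //.
by have := mulr_ge0 (normr_ge0 (complex.Re z)) (normr_ge0 (complex.Im z)); lra.
Qed.

(** Balls of [cplx R] have radii in [cplx R]; a positive element there has zero imaginary part, so
    real radii suffice. *)
Lemma nbhs_cabsP z (P : cplx R -> Prop) :
  (\forall w \near z, P w) <->
  exists2 e : R, 0 < e & forall w, cabs (w - z) < e -> P w.
Proof.
split.
  case/nbhs_ballP => e /= e0 eP.
  have [e1 ee1] : exists e1 : R, e = e1%:C%C.
    by case: e e0 {eP} => x y; rewrite ltcE /= => /andP[/eqP-> _]; exists x.
  rewrite ee1 ltcR in e0; exists e1 => // w wz; apply: eP.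
  by rewrite ee1 /ball /= normr_cplx ltcR cabsB.
case=> e e0 eP; apply/nbhs_ballP; exists (e%:C%C); rewrite /= ?ltcR //.
by move=> w; rewrite /ball /= normr_cplx ltcR cabsB; exact: eP.
Qed.

Lemma cvgn_cabsP (u : nat -> cplx R) z :
  u @ \oo --> z <->
  forall e : R, 0 < e -> exists N, forall n, (N <= n)%N -> cabs (u n - z) < e.
Proof.
split=> [uz e e0|H].
  have : \forall w \near z, cabs (w - z) < e by apply/nbhs_cabsP; exists e.
  by move/uz => [N _ NP]; exists N => n Nn; exact: NP.
move=> A /nbhs_cabsP[e /H[N NP] eA].
by exists N => // n /= Nn; apply: eA; exact: NP.
Qed.

Lemma cvg_conj (u : nat -> cplx R) z :
  u @ \oo --> z -> (fun n => ((u n)^*)%C : cplx R) @ \oo --> ((z^*)%C : cplx R).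
Proof.
move=> /cvgn_cabsP H; apply/cvgn_cabsP => e /H[N NP]; exists N => n /NP.
by rewrite -cabs_conj rmorphB.
Qed.

Lemma cvgn_cabs_le (u : nat -> cplx R) z (C : R) N :
  u @ \oo --> z -> (forall n, (N <= n)%N -> cabs (u n) <= C) -> cabs z <= C.
Proof.
move=> /cvgn_cabsP H uC; apply/ler_addgt0Pr => e /H[N1 NP].
have := NP (maxn N N1) (leq_maxr _ _); have := uC (maxn N N1) (leq_maxl _ _).
have := ler_cabsD (z - u (maxn N N1)) (u (maxn N N1)).
by rewrite subrK cabsB; lra.
Qed.

Lemma cvgn_Re_Im (u : nat -> cplx R) (x y : R) :
  (fun n => complex.Re (u n)) @ \oo --> x ->
  (fun n => complex.Im (u n)) @ \oo --> y ->
  u @ \oo --> (Complex x y : cplx R).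
Proof.
move=> /cvgrPdist_lt ux /cvgrPdist_lt uy; apply/cvgn_cabsP => e e0.
have e2 : 0 < e / 2 by rewrite divr_gt0.
have [N1 _ N1P] := ux _ e2; have [N2 _ N2P] := uy _ e2.
exists (maxn N1 N2) => n; rewrite geq_max => /andP[/N1P/= h1 /N2P/= h2].
apply: le_lt_trans (cabs_le_ReIm _) _; rewrite [e]splitr.
by rewrite raddfB raddfB /= ltrD // distrC.
Qed.

End ComplexModulus.

(** * Power series *)

Section PowerSeries.
Variable R : realType.
Implicit Types (z t : cplx R) (c u : nat -> cplx R) (r q B : R).

Lemma sum_geometric_le q (L N : nat) : 0 <= q < 1 ->
  \sum_(L <= n < N) q ^+ n <= q ^+ L / (1 - q).
Proof.
move=> /andP[q0 q1]; have q1' : 0 < 1 - q by rewrite subr_gt0.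
have [NL|LN] := leqP N L.
  by rewrite big_geq // divr_ge0 ?exprn_ge0 // ltW.
rewrite ler_pdivlMr // mulrBr mulr1 mulr_suml.
rewrite -sumrB; under eq_bigr do rewrite -exprSr -opprB.
by rewrite sumrN telescope_sumr ?(ltnW LN)// opprB gerBl exprn_ge0.
Qed.

(** Each [q ^+ i] with [i < n] is at least [q ^+ n], so the geometric sum dominates [n] copies of
    [q ^+ n]. *)
Lemma natr_mul_expr_le q n : 0 <= q < 1 -> n%:R * q ^+ n <= (1 - q)^-1.
Proof.
move=> q01; have /andP[q0 q1] := q01.
have := sum_geometric_le 0 n q01; rewrite expr0 div1r; apply: le_trans.
rewrite mulr_natl -[X in _ *+ X]subn0 -sumr_const_nat.
rewrite !big_nat; apply: ler_sum => i /andP[_ ik].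
by apply: ler_wiXn2l; rewrite ?(ltW q1) // ltnW.
Qed.

(** Real and imaginary parts converge absolutely by comparison with a geometric series, so
    completeness is used over the reals only. *)
Lemma cvgn_geometric_bound u B q : 0 <= q < 1 ->
  (forall n, (1 <= n)%N -> cabs (u n) <= B * q ^+ n) ->
  cvgn (fun N => \sum_(1 <= n < N) u n).
Proof.
move=> /andP[q0 q1] uB.
have key (f : cplx R -> R) : f 0 = 0 -> (forall z, `|f z| <= cabs z) ->
    {morph f : x y / x + y} ->
    cvgn (fun N => f (\sum_(1 <= n < N) u n)).
  move=> f0 fle fD.
  have -> : (fun N => f (\sum_(1 <= n < N) u n)) =
      series (fun n => if n == 0%N then 0 else f (u n)).
    apply/funext => N; rewrite (big_morph f fD f0) /series /=.
    case: N => [|N]; first by rewrite !big_geq.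
    rewrite [RHS]big_ltn // add0r !big_nat; apply: eq_bigr => i /andP[i1 _].
    by case: i i1.
  apply: normed_cvg; apply: (@series_le_cvg _ _ (geometric (`|B|) q)).
  - by move=> n; exact: normr_ge0.
  - by move=> n; rewrite mulr_ge0 ?exprn_ge0.
  - move=> [|n] /=; first by rewrite normr0 mulr_ge0 ?exprn_ge0.
    apply: le_trans (fle _) _; apply: le_trans (uB _ _) _ => //.
    by rewrite ler_wpM2r ?exprn_ge0 ?ler_norm.
  - by apply: is_cvg_geometric_series; rewrite ger0_norm.
have /cvg_ex[x ux] : cvgn (fun N => complex.Re (\sum_(1 <= n < N) u n)).
  by apply: key => //; [exact: normr_Re_le_cabs | exact: raddfD].
have /cvg_ex[y uy] : cvgn (fun N => complex.Im (\sum_(1 <= n < N) u n)).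
  by apply: key => //; [exact: normr_Im_le_cabs | exact: raddfD].
by apply/cvg_ex; exists (Complex x y); exact: cvgn_Re_Im.
Qed.

Lemma cabs_sum_geometric u B q (L N : nat) : 0 <= B -> 0 <= q < 1 -> (1 <= L)%N ->
  (forall n, (1 <= n)%N -> cabs (u n) <= B * q ^+ n) ->
  cabs (\sum_(L <= n < N) u n) <= B * (q ^+ L / (1 - q)).
Proof.
move=> B0 q01 L1 uB; apply: le_trans (cabs_sum _ _ _) _.
apply: (@le_trans _ _ (\sum_(L <= n < N) B * q ^+ n)).
  by rewrite !big_nat; apply: ler_sum => i /andP[Li _]; apply/uB/(leq_trans L1).
by rewrite -mulr_sumr ler_wpM2l // sum_geometric_le.
Qed.

Lemma cabs_tail_geometric u B q l (L : nat) : 0 <= B -> 0 <= q < 1 -> (1 <= L)%N ->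
  (forall n, (1 <= n)%N -> cabs (u n) <= B * q ^+ n) ->
  (fun N => \sum_(1 <= n < N) u n) @ \oo --> l ->
  cabs (l - \sum_(1 <= n < L) u n) <= B * (q ^+ L / (1 - q)).
Proof.
move=> B0 q01 L1 uB ul.
apply: (@cvgn_cabs_le _ (fun N => \sum_(1 <= n < N) u n - \sum_(1 <= n < L) u n)
  _ _ L).
  exact: (cvgnB ul (@cvgn_cst (cplx R) _)).
move=> N LN; rewrite (big_cat_nat L1 LN) /= [X in X - _]addrC addrK.
exact: cabs_sum_geometric.
Qed.

Definition psum c N z : cplx R := \sum_(1 <= n < N) c n * z ^+ n.

Definition pser c z : cplx R := limn (fun N => psum c N z).

Lemma cvg_pser c z : pseries1_analytic c -> unit_disk z ->
  (fun N => psum c N z) @ \oo --> pser c z.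
Proof. by move=> hc hz; have := hc z hz; rewrite /pser; exact. Qed.

(** The working form of convergence inside the disk: the gap between [q] and 1 absorbs polynomial
    factors in [n], and the majorant depends on the radius alone. *)
Definition geometric_decay c r := exists B q,
  [/\ 0 <= B, 0 <= q < 1 &
      forall n, (1 <= n)%N -> cabs (c n) * r ^+ n <= B * q ^+ n].

(** Convergence at a radius [s] strictly between [r] and 1 makes the terms [c n * s ^+ n] bounded;
    then [q = r / s]. *)
Lemma pseries1_analytic_decay c r : pseries1_analytic c -> 0 <= r < 1 ->
  geometric_decay c r.
Proof.
move=> hc /andP[r0 r1].
set s : R := (1 + r) / 2.
have s0 : 0 < s by rewrite /s; lra.
have s1 : s < 1 by rewrite /s; lra.
have rs : r < s by rewrite /s; lra.
have /hc/cvg_ex[l /cvgn_cabsP/(_ 1 ltr01)[N NP]] : unit_disk (s%:C%C : cplx R).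
  by change (cabs (s%:C%C : cplx R) < 1); rewrite cabs_real gtr0_norm.
set b := fun n => cabs (c n) * s ^+ n.
have b0 n : 0 <= b n by rewrite mulr_ge0 ?cabs_ge0 ?exprn_ge0 // ltW.
(* The constant 2 bounds the terms from index [N] on, the sum bounds the finitely many earlier
   ones. *)
exists (2 + \sum_(0 <= n < N.+1) b n), (r / s).
have B0 : 0 <= \sum_(0 <= n < N.+1) b n by apply: sumr_ge0.
split; first by rewrite addr_ge0.
  by rewrite divr_ge0 ?(ltW s0) //= ltr_pdivrMr // mul1r.
move=> n n1; rewrite expr_div_n mulrCA [X in X <= _]mulrC ler_wpM2l ?exprn_ge0 //.
rewrite ler_pdivlMr ?exprn_gt0 //; rewrite -/(b n).
have [nN|Nn] := ltnP n N.
  apply: (@le_trans _ _ (\sum_(0 <= n < N.+1) b n)); last by lra.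
  rewrite (bigD1_seq n) ?iota_uniq //=; last by rewrite mem_index_iota /= ltnW.
  by rewrite lerDl sumr_ge0.
have := NP n Nn; have := NP n.+1 (leq_trans Nn (leqnSn _)).
rewrite big_nat_recr //= => h1 h2.
have : cabs (c n * s%:C%C ^+ n) < 2.
  set S := \sum_(1 <= i < n) _ in h1 h2.
  (* The term is the difference of two consecutive partial sums, each within 1 of the limit [l]. *)
  have -> : c n * s%:C%C ^+ n = (S + c n * s%:C%C ^+ n - l) - (S - l) by ring.
  apply: le_lt_trans (ler_cabsD _ _) _; rewrite cabsN.
  by apply: lt_le_trans (ltrD h1 h2) _; lra.
rewrite cabsM cabsX cabs_real gtr0_norm // -/(b n).
by lra.
Qed.

Lemma decay_pseries1_analytic c :
  (forall r, 0 <= r < 1 -> geometric_decay c r) -> pseries1_analytic c.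
Proof.
move=> H z zD.
have [|B [q [B0 q01 cB]]] := H (cabs z); first by rewrite cabs_ge0.
apply: (@cvgn_geometric_bound _ B q) => // n n1.
by rewrite cabsM cabsX; exact: cB.
Qed.

(** Write [q = (q / s) * s] with [q < s < 1]: the powers of [q / s] compensate the factor [n], those
    of [s] keep the decay. *)
Lemma geometric_decayMn c r : geometric_decay c r ->
  geometric_decay (fun n => n%:R * c n) r.
Proof.
move=> [B [q [B0 /andP[q0 q1] cB]]].
set s : R := (1 + q) / 2.
have s0 : 0 < s by rewrite /s; lra.
have s1 : s < 1 by rewrite /s; lra.
have qs : q < s by rewrite /s; lra.
have t01 : 0 <= q / s < 1.
  by rewrite divr_ge0 ?(ltW s0) //= ltr_pdivrMr // mul1r.
have t1 : 0 < 1 - q / s by case/andP: t01; lra.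
exists (B * (1 - q / s)^-1), s; split.
- by rewrite mulr_ge0 // invr_ge0 ltW.
- by rewrite ltW.
move=> n n1; rewrite cabsM cabs_nat.
have -> : n%:R * cabs (c n) * r ^+ n = n%:R * (cabs (c n) * r ^+ n) by rewrite mulrA.
apply: (@le_trans _ _ (n%:R * (B * q ^+ n))); first by rewrite ler_wpM2l // cB.
have -> : q ^+ n = (q / s) ^+ n * s ^+ n by rewrite -exprMn divfK // gt_eqF.
rewrite mulrCA -[X in _ <= X]mulrA ler_wpM2l // mulrA.
by rewrite ler_wpM2r ?exprn_ge0 ?(ltW s0) //; exact: natr_mul_expr_le.
Qed.

(** The new coefficients are those of [z] times the derivative of the series. *)
Lemma pseries1_analyticMn c : pseries1_analytic c ->
  pseries1_analytic (fun n => n%:R * c n).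
Proof.
move=> hc; apply: decay_pseries1_analytic => r r01.
exact/geometric_decayMn/pseries1_analytic_decay.
Qed.

(** The remainder satisfies [E_(n+1) = (1 + t) E_n + n t^2], and [n^2 + n <= (n + 1)^2] closes the
    induction. The factor [(1 + d) ^+ n] is later absorbed by enlarging the radius. *)
Lemma expr_1D_taylor (d : R) t n : cabs t <= d ->
  cabs ((1 + t) ^+ n - 1 - n%:R * t) <= n%:R ^+ 2 * (1 + d) ^+ n * cabs t ^+ 2.
Proof.
move=> td; have t0 := cabs_ge0 t.
have t1 : cabs (1 + t) <= 1 + d.
  by apply: le_trans (ler_cabsD _ _) _; rewrite cabs1; lra.
elim: n => [|n IH].
  by rewrite expr0 subrr mul0r subr0 cabs0 !expr0n /= !mul0r.
have -> : (1 + t) ^+ n.+1 - 1 - n.+1%:R * t =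
   (1 + t) * ((1 + t) ^+ n - 1 - n%:R * t) + n%:R * t ^+ 2.
  by rewrite exprS -natr1; ring.
apply: le_trans (ler_cabsD _ _) _; rewrite cabsM [cabs (_ * t ^+ 2)]cabsM cabs_nat cabsX.
have d1 : 1 <= (1 + d) ^+ n.+1 by apply: exprn_ege1; lra.
apply: (@le_trans _ _ ((1 + d) * (n%:R ^+ 2 * (1 + d) ^+ n * cabs t ^+ 2)
                        + n%:R * (1 + d) ^+ n.+1 * cabs t ^+ 2)).
  apply: lerD; first by apply: ler_pM; rewrite ?cabs_ge0.
  by rewrite ler_wpM2r ?sqr_ge0 // ler_peMr.
rewrite -subr_ge0 [X in 0 <= X](_ : _ =
   (n%:R + 1) * (1 + d) ^+ n.+1 * cabs t ^+ 2); last by rewrite -natr1 (exprS (1 + d) n); ring.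
by rewrite !mulr_ge0 ?sqr_ge0 //; lra.
Qed.

Lemma pser_taylor c z : pseries1_analytic c -> unit_disk z ->
  exists C d : R, [/\ 0 < d, 0 <= C & forall t, cabs t < d ->
    cabs (pser c (z * (1 + t)) - pser c z - pser (fun n => n%:R * c n) z * t)
      <= C * cabs t ^+ 2].
Proof.
move=> hc hz; have r0 := cabs_ge0 z; have r1 : cabs z < 1 by [].
(* Half the distance to the unit circle keeps [cabs z * (1 + d)] below 1. *)
set d := (1 - cabs z) / 2.
have d0 : 0 < d by rewrite /d; lra.
have rd1 : 0 <= cabs z * (1 + d) < 1.
  rewrite mulr_ge0 //=; last by lra.
  by have := mulr_gt0 d0 (_ : 0 < 1 - cabs z); rewrite /d; nra.
(* The coefficients [n^2 c n] decay geometrically at the enlarged radius, which absorbs both factors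
   from [expr_1D_taylor]. *)
have hc2 := pseries1_analyticMn (pseries1_analyticMn hc).
have [B [q [B0 q01 cB]]] := pseries1_analytic_decay hc2 rd1.
have q1 : 0 < 1 - q by case/andP: q01; lra.
exists (B * (q ^+ 1 / (1 - q))), d; split => //.
  by rewrite mulr_ge0 // divr_ge0 ?exprn_ge0 ?(ltW q1) //; case/andP: q01.
move=> t td; have t0 := cabs_ge0 t.
have hzt : unit_disk (z * (1 + t)).
  case/andP: rd1 => _; apply: le_lt_trans; rewrite cabsM ler_wpM2l //.
  by apply: le_trans (ler_cabsD _ _) _; rewrite cabs1 lerD2l ltW.
apply: (@cvgn_cabs_le _ (fun N => psum c N (z * (1 + t)) - psum c N z
   - psum (fun n => n%:R * c n) N z * t) _ _ 1).
  have hD := cvg_pser (pseries1_analyticMn hc) hz.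
  exact: (cvgnB (cvgnB (cvg_pser hc hzt) (cvg_pser hc hz)) (cvgnMr (y := t) hD)).
move=> N _; rewrite /psum mulr_suml -!sumrB.
have -> : B * (q ^+ 1 / (1 - q)) * cabs t ^+ 2
   = (B * cabs t ^+ 2) * (q ^+ 1 / (1 - q)) by ring.
apply: cabs_sum_geometric => //; first by rewrite mulr_ge0 ?sqr_ge0.
move=> n n1.
have -> : c n * (z * (1 + t)) ^+ n - c n * z ^+ n - n%:R * c n * z ^+ n * t
   = c n * z ^+ n * ((1 + t) ^+ n - 1 - n%:R * t) by rewrite exprMn; ring.
have -> : B * cabs t ^+ 2 * q ^+ n = B * q ^+ n * cabs t ^+ 2 by ring.
apply: (@le_trans _ _ (cabs (n%:R * (n%:R * c n)) * (cabs z * (1 + d)) ^+ n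
   * cabs t ^+ 2)); last by rewrite ler_wpM2r ?sqr_ge0 // cB.
rewrite !cabsM cabs_nat cabsX exprMn.
have -> : n%:R * (n%:R * cabs (c n)) * (cabs z ^+ n * (1 + d) ^+ n) * cabs t ^+ 2
  = cabs (c n) * cabs z ^+ n * (n%:R ^+ 2 * (1 + d) ^+ n * cabs t ^+ 2) by ring.
rewrite ler_wpM2l ?mulr_ge0 ?cabs_ge0 ?exprn_ge0 //.
by apply: expr_1D_taylor; exact: ltW.
Qed.

Lemma pser_uniform c r (e : R) : pseries1_analytic c -> 0 <= r < 1 -> 0 < e ->
  exists L0, forall L z, (L0 <= L)%N -> cabs z = r ->
    cabs (pser c z - psum c L z) <= e.
Proof.
move=> hc r01 e0.
have [B [q [B0 q01 cB]]] := pseries1_analytic_decay hc r01.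
have q1 : 0 < 1 - q by case/andP: q01; lra.
have /cvgrPdist_lt/(_ _ e0)[L0 _ L0P] :
    (geometric (B / (1 - q)) q : nat -> R) @ \oo --> 0.
  by apply: cvg_geometric; case/andP: q01 => ? ?; rewrite ger0_norm.
exists L0.+1 => L z L0L zr.
have hz : unit_disk z by rewrite /unit_disk /= zr; case/andP: r01.
apply: (@le_trans _ _ (B * (q ^+ L / (1 - q)))).
  apply: cabs_tail_geometric => //; first exact: leq_trans L0L.
  - by move=> n n1; rewrite cabsM cabsX zr; exact: cB.
  - exact: cvg_pser.
have := L0P L (ltnW L0L); rewrite /= sub0r normrN => /ltW.
by apply: le_trans; apply: le_trans (ler_norm _); rewrite mulrA mulrAC.
Qed.

End PowerSeries.

(** * Relative Wirtinger derivatives *)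

Section EulerDerivatives.
Variable R : realType.
Implicit Types (z t al be : cplx R) (f g : cplx R -> cplx R).

(* First-order expansion of [f] along the relative increment [z t]: [al] and
   [be] stand for [z f_z] and [conj z f_zbar]. *)
Definition euler_diff f z al be := exists C d : R,
  [/\ 0 < d, 0 <= C & forall t, cabs t < d ->
      cabs (f (z * (1 + t)) - f z - (al * t + be * (t^*)%C)) <= C * cabs t ^+ 2].

Lemma euler_diff_eq f z al be al' be' :
  euler_diff f z al be -> al = al' -> be = be' -> euler_diff f z al' be'.
Proof. by move=> h <- <-. Qed.

Lemma euler_diff_cst (c z : cplx R) : euler_diff (fun=> c) z 0 0.
Proof.
exists 0, 1; split => // t _.
by rewrite !mul0r addr0 !subrr cabs0.
Qed.

Lemma euler_diff_id z : euler_diff id z z 0.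
Proof.
exists 0, 1; split => // t _; rewrite mul0r [X in _ <= X]mul0r.
by rewrite [X in cabs X](_ : _ = 0) ?cabs0 //; ring.
Qed.

Lemma euler_diff_conj f z al be : euler_diff f z al be ->
  euler_diff (fun w => ((f w)^*)%C) z (be^*)%C (al^*)%C.
Proof.
move=> [C [d [d0 C0 H]]]; exists C, d; split => // t /H.
rewrite -cabs_conj !(rmorphB, rmorphD, rmorphM) /= conjcK.
by rewrite [(be^*)%C * _ + _]addrC.
Qed.

Lemma euler_diffD f g z al be al' be' :
  euler_diff f z al be -> euler_diff g z al' be' ->
  euler_diff (fun w => f w + g w) z (al + al') (be + be').
Proof.
move=> [C [d [d0 C0 H]]] [C' [d' [d0' C0' H']]].
exists (C + C'), (Num.min d d'); split; rewrite ?lt_min ?d0 ?addr_ge0 // => t.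
rewrite lt_min => /andP[/H h /H' h'].
rewrite [X in cabs X](_ : _ =
  (f (z * (1 + t)) - f z - (al * t + be * (t^*)%C)) +
  (g (z * (1 + t)) - g z - (al' * t + be' * (t^*)%C))); last by ring.
by rewrite mulrDl; apply: le_trans (ler_cabsD _ _) (lerD h h').
Qed.

Lemma euler_diff_sum (I : eqType) (s : seq I) (f : I -> cplx R -> cplx R) z
    (al be : I -> cplx R) :
  (forall i, i \in s -> euler_diff (f i) z (al i) (be i)) ->
  euler_diff (fun w => \sum_(i <- s) f i w) z
    (\sum_(i <- s) al i) (\sum_(i <- s) be i).
Proof.
elim: s => [|i s IH] H.
  rewrite !big_nil; have -> : (fun w => \sum_(i <- [::]) f i w) = fun=> 0.
    by apply/funext => w; rewrite big_nil.
  exact: euler_diff_cst.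
rewrite !big_cons; have -> : (fun w => \sum_(j <- i :: s) f j w)
    = fun w => f i w + \sum_(j <- s) f j w.
  by apply/funext => w; rewrite big_cons.
apply: euler_diffD; first by apply: H; rewrite mem_head.
by apply: IH => j js; apply: H; rewrite inE js orbT.
Qed.

(** The error is the remainder of [f] times [g z], plus [f z] times the remainder of [g], plus the
    product of the two increments; each is of second order in [t]. *)
Lemma euler_diffM f g z al be al' be' :
  euler_diff f z al be -> euler_diff g z al' be' ->
  euler_diff (fun w => f w * g w) z
    (al * g z + f z * al') (be * g z + f z * be').
Proof.
have incr h z' a b : euler_diff h z' a b -> exists C d : R,
    [/\ 0 < d, 0 <= C & forall t, cabs t < d ->
      cabs (h (z' * (1 + t)) - h z') <= C * cabs t].
  move=> [C [d [d0 C0 H]]].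
  exists (C * d + (cabs a + cabs b)), d; split => //.
    by rewrite !addr_ge0 ?mulr_ge0 ?cabs_ge0 // ltW.
  move=> t td; have t0 := cabs_ge0 t.
  have := H t td; set X := h _ - h z'.
  have := ler_cabsD (X - (a * t + b * (t^*)%C)) (a * t + b * (t^*)%C).
  have := ler_cabsD (a * t) (b * (t^*)%C).
  rewrite subrK !cabsM cabs_conj => h1 h2 h3.
  have : C * cabs t ^+ 2 <= C * d * cabs t.
    by rewrite expr2 mulrA ler_wpM2r // ler_wpM2l // ltW.
  by lra.
move=> Ef Eg; have [Cf [df [df0 Cf0 Hf]]] := incr _ _ _ _ Ef.
have [Cg [dg [dg0 Cg0 Hg]]] := incr _ _ _ _ Eg.
move: Ef Eg => [C [d [d0 C0 H]]] [C' [d' [d0' C0' H']]].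
exists (C * cabs (g z) + cabs (f z) * C' + Cf * Cg),
  (Num.min (Num.min d d') (Num.min df dg)); split.
- by rewrite !lt_min d0 d0' df0.
- by rewrite !addr_ge0 ?mulr_ge0 ?cabs_ge0.
move=> t; rewrite !lt_min => /andP[/andP[/H h /H' h'] /andP[/Hf hf /Hg hg]].
rewrite [X in cabs X](_ : _ =
  (f (z * (1 + t)) - f z - (al * t + be * (t^*)%C)) * g z +
  f z * (g (z * (1 + t)) - g z - (al' * t + be' * (t^*)%C)) +
  (f (z * (1 + t)) - f z) * (g (z * (1 + t)) - g z)); last by ring.
rewrite [X in _ <= X]mulrDl [X in _ <= X + _]mulrDl.
apply: le_trans (ler_cabsD _ _) (lerD _ _).
  apply: le_trans (ler_cabsD _ _) (lerD _ _); rewrite cabsM.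
    by rewrite mulrAC ler_wpM2r ?cabs_ge0.
  by rewrite -mulrA ler_wpM2l ?cabs_ge0.
rewrite cabsM [X in _ <= X](_ : _ = (Cf * cabs t) * (Cg * cabs t)); last by ring.
by apply: ler_pM; rewrite ?cabs_ge0.
Qed.

Lemma sqr_normr_cplx z : `|z| ^+ 2 = z * (z^*)%C :> cplx R.
Proof. by rewrite -sqr_cabs normr_cplx -rmorphXn. Qed.

Lemma euler_diff_normX z m : euler_diff (fun w => `|w| ^+ (2 * m)) z
  (m%:R * `|z| ^+ (2 * m)) (m%:R * `|z| ^+ (2 * m)).
Proof.
elim: m => [|m IH].
  rewrite !mul0r; have -> : (fun w : cplx R => `|w| ^+ (2 * 0)) = fun=> 1.
    by apply/funext => w; rewrite expr0.
  exact: euler_diff_cst.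
have -> : (fun w : cplx R => `|w| ^+ (2 * m.+1)) =
    fun w => (w * (w^*)%C) * `|w| ^+ (2 * m).
  by apply/funext => w; rewrite mulnS exprD sqr_normr_cplx.
have Ez : euler_diff (fun w => w * (w^*)%C) z (z * (z^*)%C) (z * (z^*)%C).
  apply: euler_diff_eq (euler_diffM (euler_diff_id z)
    (euler_diff_conj (euler_diff_id z))) _ _; last by ring.
  by rewrite conj0; ring.
by apply: euler_diff_eq (euler_diffM Ez IH) _ _;
  rewrite mulnS exprD sqr_normr_cplx -(natr1 m); ring.
Qed.

Lemma euler_diff_pser (c : nat -> cplx R) z : pseries1_analytic c -> unit_disk z ->
  euler_diff (pser c) z (pser (fun n => n%:R * c n) z) 0.
Proof.
move=> hc hz; have [C [d [d0 C0 H]]] := pser_taylor hc hz.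
by exists C, d; split => // t /H; rewrite mul0r addr0.
Qed.

(** The series form holds in the disk only; a relative increment shorter than [1 - cabs z] does not
    leave it. *)
Lemma euler_diff_disk f g z al be : unit_disk z ->
  (forall w, unit_disk w -> f w = g w) ->
  euler_diff g z al be -> euler_diff f z al be.
Proof.
move=> hz fg [C [d [d0 C0 H]]].
have z0 := cabs_ge0 z; have z1 : cabs z < 1 by [].
exists C, (Num.min d (1 - cabs z)); split => //.
  by rewrite lt_min d0 subr_gt0.
move=> t; rewrite lt_min => /andP[td tz]; rewrite !fg //; first exact: H.
rewrite /unit_disk /= cabsM.
have t0 := cabs_ge0 t.
have := ler_cabsD 1 t; rewrite cabs1 => h.
apply: (@le_lt_trans _ _ (cabs z * (1 + cabs t))); first by rewrite ler_wpM2l.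
by nra.
Qed.

Lemma derive1_quadratic (h : R -> R) (x l C d : R) : 0 < d -> 0 <= C ->
  (forall s, `|s| < d -> `|h (s + x) - h x - l * s| <= C * s ^+ 2) ->
  derive1 h x = l.
Proof.
move=> d0 C0 H; rewrite /derive1; apply: cvg_lim => //.
apply/cvgrPdist_le => e e0.
near=> s.
have s0 : s != 0 by near: s; exact: nbhs_dnbhs_neq.
have sd : `|s| < d.
  near: s; apply: dnbhs0_lt => //.
(* The quotient differs from [l] by at most [C * |s|]; [C + 1] is positive even when [C] is 0. *)
have se : `|s| < e / (C + 1).
  by near: s; apply: dnbhs0_lt; rewrite divr_gt0 // ltr_wpDl.
rewrite /= [X in `|X|](_ : _ = - (s^-1 * (h (s + x) - h x - l * s))); last first.
  by rewrite /GRing.scale /=; field.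
rewrite normrN normrM normfV ler_pdivrMl ?normr_gt0 //.
apply: le_trans (H s sd) _; rewrite -real_normK ?num_real // expr2 mulrCA.
rewrite ler_wpM2l // ; move: se; rewrite ltr_pdivlMr ?ltr_wpDl // => se.
by have := normr_ge0 s; nra.
Unshelve. all: by end_near. Qed.

Lemma cderive_quadratic (h : R -> cplx R) (x C d : R) (l : cplx R) :
  0 < d -> 0 <= C ->
  (forall s, `|s| < d ->
     cabs (h (s + x) - h x - l * (s%:C%C : cplx R)) <= C * s ^+ 2) ->
  cderive h x = l.
Proof.
move=> d0 C0 H; rewrite /cderive.
rewrite (@derive1_quadratic _ x (complex.Re l) C d) //; last first.
  move=> s /H; apply: le_trans.
  apply: le_trans (normr_Re_le_cabs _).
  by rewrite !raddfB /=; case: l {H} => a b /=; rewrite mulr0 subr0.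
rewrite (@derive1_quadratic _ x (complex.Im l) C d) //; last first.
  move=> s /H; apply: le_trans.
  apply: le_trans (normr_Im_le_cabs _).
  by rewrite !raddfB /=; case: l {H} => a b /=; rewrite mulr0 add0r mulrC.
by case: l {H}.
Qed.

(** A step [v * s] from [z] is the relative increment [v * s / z]. The directions 1 and ['i] give
    the horizontal and vertical slices. *)
Lemma euler_diff_slice f z (v al be : cplx R) (h : R -> cplx R) (x : R) :
  z != 0 -> cabs v = 1 -> (forall s, h (s + x) = f (z + v * s%:C%C)) ->
  euler_diff f z al be ->
  cderive h x = al / z * v + be / (z^*)%C * (v^*)%C.
Proof.
move=> z0 v1 hf [C [d [d0 C0 H]]].
have r0 : 0 < cabs z by rewrite lt_neqAle eq_sym cabs_eq0 z0 cabs_ge0.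
have zc0 : (z^*)%C != 0 :> cplx R by rewrite conjc_eq0.
apply: (@cderive_quadratic _ _ (C / cabs z ^+ 2) (d * cabs z)).
- by rewrite mulr_gt0.
- by rewrite divr_ge0 ?sqr_ge0.
move=> s sd.
have h0 : h x = f z by rewrite -[x]add0r hf mulr0 addr0.
rewrite hf h0; pose t : cplx R := v * s%:C%C / z.
have -> : z + v * s%:C%C = z * (1 + t) by rewrite /t; field.
have -> : (al / z * v + be / (z^*)%C * (v^*)%C) * s%:C%C = al * t + be * (t^*)%C.
  have -> : (t^*)%C = (v^*)%C * s%:C%C / (z^*)%C.
    by rewrite -(conjc_inv z) /t 2!conjM conj_real.
  by rewrite /t; field; rewrite zc0.
have tE : cabs t = `|s| / cabs z by rewrite /t !cabsM v1 mul1r cabs_real cabsV.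
have -> : C / cabs z ^+ 2 * s ^+ 2 = C * cabs t ^+ 2.
  by rewrite tE expr_div_n real_normK ?num_real //; ring.
by apply: H; rewrite tE ltr_pdivrMr.
Qed.

Lemma euler_diff_dz f z al be : z != 0 -> euler_diff f z al be ->
  dz f z = al / z /\ dzbar f z = be / (z^*)%C.
Proof.
move=> z0 E.
have px : pdx f z = al / z + be / (z^*)%C.
  rewrite /pdx (@euler_diff_slice f z 1 al be _ _ z0) ?cabs1 //.
    by rewrite conjc1 !mulr1.
  move=> s; rewrite /horiz_slice mul1r; congr f.
  by case: z {z0 E} => x y /=; congr Complex => /=; ring.
have py : pdy f z = 'i%C * (al / z - be / (z^*)%C).
  rewrite /pdy (@euler_diff_slice f z 'i%C al be _ _ z0) //.
  - have -> : ('i^*)%C = - 'i%C :> cplx R.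
      by apply/eqP; rewrite eq_complex /= oppr0 !eqxx.
    by ring.
  - by rewrite cabsE /= expr0n add0r expr1n sqrtr1.
  move=> s; rewrite /vert_slice; congr f.
  by case: z {z0 E px} => x y /=; congr Complex => /=; ring.
have ii : ('i%C : cplx R) * 'i%C = -1.
  by apply/eqP; rewrite eq_complex /=; apply/andP; split; apply/eqP; ring.
have two0 : (2 : cplx R) != 0 by rewrite pnatr_eq0.
rewrite /dz /dzbar px py !mulrA ii; split.
  by apply: (mulIf two0); rewrite divfK //; ring.
by apply: (mulIf two0); rewrite divfK //; ring.
Qed.

End EulerDerivatives.

(** * Discrete Parseval identity *)

Section DiscreteParseval.
Variable R : realType.
Implicit Types (z w x : cplx R) (P Q d : nat -> cplx R).

Definition expi (t : R) : cplx R := Complex (cos t) (sin t).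

Lemma expiX t n : expi t ^+ n = expi (n%:R * t).
Proof.
elim: n => [|n IH]; first by rewrite expr0 mul0r /expi cos0 sin0.
rewrite exprS IH -natr1 mulrDl mul1r addrC /expi cosD sinD.
by apply/eqP; rewrite eq_complex /=; apply/andP; split; apply/eqP; ring.
Qed.

Lemma cplx_prim_root_exists n : (0 < n)%N ->
  exists w : cplx R, n.-primitive_root w.
Proof.
move=> n0; have nR0 : 0 < n%:R :> R by rewrite ltr0n.
have pi0 := pi_gt0 R.
exists (expi (2 * pi / n%:R)); apply/andP; split=> //; apply/forallP => i.
rewrite unity_rootE expiX mulrCA.
case: (eqVneq i.+1 n) => [->|ne].
  rewrite divff ?(gt_eqF nR0) ?mulr1 //.
  rewrite mulr_natl /expi.
  by rewrite cos2pi sin2pi eqxx.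
have iltn : (i.+1 < n)%N by rewrite ltn_neqAle ne ltn_ord.
apply/eqP/negbTE/eqP => -[c1 _]; move: c1.
(* Half the angle of the power lies strictly between 0 and [pi], so its sine is positive and the
   cosine of the full angle is not 1. *)
pose x : R := pi * (i.+1%:R / n%:R).
have -> : 2 * pi * (i.+1%:R / n%:R) = x + x :> R by rewrite /x; ring.
have : 0 < sin x.
  apply: sin_gt0_pi; rewrite /x mulr_gt0 ?divr_gt0 //=.
  by rewrite gtr_pMr // ltr_pdivrMr // mul1r ltr_nat.
by rewrite cosD => s0; have := cos2Dsin2 x; nra.
Qed.

Lemma unity_root_cabs w N : (0 < N)%N -> w ^+ N = 1 -> cabs w = 1.
Proof.
move=> N0 wN; have : cabs w ^+ N = 1 by rewrite -cabsX wN cabs1.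
by move/eqP; rewrite pexpr_eq1 ?cabs_ge0 // => /eqP.
Qed.

Lemma conj_unit z : cabs z = 1 -> z * (z^*)%C = 1.
Proof. by move=> z1; rewrite -sqr_cabs z1 expr1n. Qed.

(** Orthogonality of characters: for [i != k] the base is an [N]-th root of unity other than 1, so
    its geometric sum vanishes. *)
Lemma sum_primitive_root N w (i k : nat) : N.-primitive_root w ->
  (i < N)%N -> (k < N)%N ->
  \sum_(j < N) (w ^+ i * (w^*)%C ^+ k) ^+ j = if i == k then N%:R else 0.
Proof.
move=> hw iN kN; have N0 : (0 < N)%N by apply: leq_trans iN.
have wN := prim_expr_order hw; have w1 := unity_root_cabs N0 wN.
have ww := conj_unit w1.
case: eqP => [->|/eqP ik].
  under eq_bigr do rewrite -exprMn ww !expr1n.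
  by rewrite sumr_const card_ord.
set x := w ^+ i * _.
have x1 : x != 1.
  apply: contra_neq ik => x1.
  have : w ^+ i = w ^+ k.
    by rewrite -[RHS]mul1r -x1 /x -mulrA -exprMn [(w^*)%C * w]mulrC ww expr1n mulr1.
  by move/eqP; rewrite (eq_prim_root_expr hw) !modn_small // => /eqP.
have xN : x ^+ N = 1.
  by rewrite /x exprMn -!exprM ![(_ * N)%N]mulnC !exprM -conjX wN conjc1 !expr1n mulr1.
apply/eqP; have := subrX1 x N; rewrite xN subrr => /esym/eqP.
by rewrite mulf_eq0 subr_eq0 (negbTE x1).
Qed.

Lemma discrete_parseval N w d : N.-primitive_root w ->
  \sum_(j < N) cabs (\sum_(i < N) d i * (w ^+ j) ^+ i) ^+ 2
    = N%:R * \sum_(i < N) cabs (d i) ^+ 2.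
Proof.
move=> hw; apply: (@complexI R).
rewrite (raddf_sum (real_complex R)) (rmorphM (real_complex R)) (rmorph_nat (real_complex R)).
rewrite (raddf_sum (real_complex R)) /=.
transitivity (\sum_(j < N) \sum_(i < N) \sum_(k < N)
   (d i * ((d k)^*)%C) * (w ^+ i * (w^*)%C ^+ k) ^+ j : cplx R).
  apply: eq_bigr => j _; rewrite sqr_cabs conj_sum big_distrlr /=.
  apply: eq_bigr => i _; apply: eq_bigr => k _.
  rewrite conjM !conjX exprMn -!exprM ![(j * _)%N]mulnC; ring.
rewrite exchange_big /= mulr_sumr; apply: eq_bigr => i _.
rewrite exchange_big /= (bigD1 i) //= [X in _ + X]big1 ?addr0 => [|k ki].
  by rewrite -mulr_sumr sum_primitive_root // eqxx mulrC sqr_cabs.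
by rewrite -mulr_sumr sum_primitive_root // ifN ?mulr0 // eq_sym.
Qed.

Lemma sum_nat_cut (V : nmodType) (f : nat -> V) (L N : nat) : (L <= N)%N ->
  \sum_(1 <= n < N) (if (n < L)%N then f n else 0) = \sum_(1 <= n < L) f n.
Proof. by move=> LN; rewrite (big_nat_widen _ _ _ _ _ LN) [RHS]big_mkcond. Qed.

(** A trigonometric polynomial without constant term: on the unit circle the conjugate of [x] is its
    inverse, so [Q n] belongs to frequency [-n]. *)
Definition trig P Q L x : cplx R :=
  \sum_(1 <= n < L) (P n * x ^+ n + Q n * ((x^*)%C) ^+ n).

(** At an [N]-th root of unity frequency [-n] coincides with [N - n]; [2 * L < N] keeps these
    indices apart from the positive frequencies, and [discrete_parseval] applies. *)
Lemma trig_parseval P Q L N w : N.-primitive_root w -> (2 * L < N)%N ->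
  \sum_(j < N) cabs (trig P Q L (w ^+ j)) ^+ 2
  = N%:R * \sum_(1 <= n < L) (cabs (P n) ^+ 2 + cabs (Q n) ^+ 2).
Proof.
move=> hw LN.
have LN' : (L <= N)%N by lia.
have N0 : (0 < N)%N by lia.
pose d1 n : cplx R := if (0 < n < L)%N then P n else 0.
pose d2 n : cplx R := if (N - n < L)%N then Q (N - n)%N else 0.
(* Generic in [V] because it serves both the squared coefficients and the values at a node. *)
have split (V : nmodType) (g h : nat -> V) :
    \sum_(i < N) ((if (0 < i < L)%N then g i else 0) +
                  (if (N - i < L)%N then h (N - i)%N else 0))
    = \sum_(1 <= n < L) (g n + h n).
  rewrite big_split /= [RHS]big_split /=; congr (_ + _).
    rewrite -(big_mkord xpredT (fun i => if (0 < i < L)%N then g i else 0)) /=.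
    rewrite big_ltn //= add0r -(sum_nat_cut g LN').
    by rewrite !big_nat; apply: eq_bigr => i /andP[-> _].
  rewrite -(big_mkord xpredT (fun i => if (N - i < L)%N then h (N - i)%N else 0)) /=.
  rewrite big_nat_rev /= add0n -(@sum_nat_cut _ h L N.+1) 1?leqW // big_add1 /=.
  rewrite !big_nat; apply: eq_bigr => i /andP[_ iN].
  by rewrite subKn.
rewrite -(split _ (fun n => cabs (P n) ^+ 2) (fun n => cabs (Q n) ^+ 2)).
transitivity (N%:R * \sum_(i < N) cabs (d1 i + d2 i) ^+ 2); last first.
  congr (_ * _); apply: eq_bigr => i _; rewrite /d1 /d2.
  case: ifP => [/andP[i0 iL]|_].
    have -> : (N - i < L)%N = false by apply/negbTE; rewrite -leqNgt; lia.
    by rewrite !addr0.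
  by rewrite !add0r; case: ifP => // _; rewrite cabs0 expr0n.
rewrite -(discrete_parseval (fun i => d1 i + d2 i) hw); apply: eq_bigr => j _.
congr (cabs _ ^+ 2).
set x := w ^+ j.
have xN : x ^+ N = 1 by rewrite /x exprAC (prim_expr_order hw) expr1n.
have x1 := unity_root_cabs N0 xN.
rewrite /trig -(split _ (fun n => P n * x ^+ n) (fun n => Q n * (x^*)%C ^+ n)).
apply: eq_bigr => i _; rewrite mulrDl /d1 /d2; congr (_ + _).
  by case: ifP; rewrite ?mul0r.
case: ifP => _; rewrite ?mul0r //; congr (_ * _).
have h : x ^+ i * x ^+ (N - i) = 1 by rewrite -exprD subnKC ?xN // ltnW.
have u : (x * (x^*)%C) ^+ (N - i) = 1 by rewrite conj_unit // expr1n.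
by rewrite -[RHS]mulr1 -[X in _ = _ * X]u exprMn mulrA h mul1r.
Qed.

(** An average over nodes on the circle inherits the pointwise bound; [2 * L + 1] nodes satisfy the
    condition of [trig_parseval]. *)
Lemma trig_bessel P Q P' Q' L (C : R) :
  (forall x, cabs x = 1 ->
     cabs (trig P Q L x) ^+ 2 + cabs (trig P' Q' L x) ^+ 2 <= C) ->
  \sum_(1 <= n < L) (cabs (P n) ^+ 2 + cabs (Q n) ^+ 2)
   + \sum_(1 <= n < L) (cabs (P' n) ^+ 2 + cabs (Q' n) ^+ 2) <= C.
Proof.
move=> H; have [w hw] := @cplx_prim_root_exists (2 * L).+1 isT.
have wN := prim_expr_order hw; have w1 := unity_root_cabs (ltn0Sn _) wN.
rewrite -(@ler_pM2l _ (2 * L).+1%:R) ?ltr0n // mulrDr.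
rewrite -!(trig_parseval _ _ hw) // -big_split /=.
have -> : (2 * L).+1%:R * C = \sum_(j < (2 * L).+1) C.
  by rewrite sumr_const card_ord mulr_natl.
by apply: ler_sum => j _; apply: H; rewrite cabsX w1 expr1n.
Qed.

End DiscreteParseval.

(** * Nonnegative cross terms from the condition on the arguments *)

Section AcuteCoefficients.
Variable R : realType.
Implicit Types z w : cplx R.

(** The absolute value of [arg z] is the arc cosine of [Re z / |z|], and the cosine is nonnegative
    up to [pi / 2]. *)
Lemma arg_le_pihalf_Re_ge0 z : z != 0 -> `|arg z| <= pi / 2 -> 0 <= complex.Re z.
Proof.
move=> z0; rewrite /arg.
have r0 : 0 < cabs z by rewrite lt_neqAle eq_sym cabs_eq0 z0 cabs_ge0.
set t := complex.Re z / cabs z.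
have t1 : -1 <= t <= 1.
  rewrite -ler_norml /t normrM normfV [`|cabs z|]gtr0_norm //.
  by rewrite ler_pdivrMr // mul1r normr_Re_le_cabs.
have [/andP[a0 _] ct] := acos_def t1.
have -> : `|if 0 <= complex.Im z then acos t else - acos t| = acos t.
  by case: ifP => _; rewrite ?normrN ger0_norm.
move=> ta; have : 0 <= t.
  rewrite -ct; apply: cos_ge0_pihalf; rewrite ta andbT.
  by apply: le_trans a0; rewrite oppr_le0 divr_ge0 ?pi_ge0.
by rewrite /t pmulr_lge0 // invr_gt0.
Qed.

(** For nonzero coefficients the product with the conjugate is the quotient times a positive real; a
    zero coefficient gives 0. *)
Lemma args_within_right_angle_Re (p : nat) (c : nat -> nat -> cplx R) n k1 k2 :
  args_within_right_angle p c -> (1 <= n)%N -> (1 <= k1 <= p)%N -> (1 <= k2 <= p)%N ->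
  0 <= complex.Re (c n k1 * ((c n k2)^*)%C).
Proof.
move=> hc n1 h1 h2.
have [->|c1] := eqVneq (c n k1) 0; first by rewrite mul0r.
have [->|c2] := eqVneq (c n k2) 0.
  by rewrite conj0 mulr0.
have c12 : c n k1 / c n k2 != 0 by rewrite mulf_neq0 ?invr_eq0.
have := arg_le_pihalf_Re_ge0 c12 (hc _ _ _ n1 h1 h2 c1 c2).
have -> : c n k1 * ((c n k2)^*)%C = (c n k1 / c n k2) * (cabs (c n k2) ^+ 2)%:C%C.
  by rewrite sqr_cabs; field.
case: (c n k1 / c n k2) => x y /= x0.
by rewrite mulr0 subr0 mulr_ge0 ?sqr_ge0.
Qed.

Lemma sqr_cabsD z w :
  cabs (z + w) ^+ 2 = cabs z ^+ 2 + cabs w ^+ 2 + 2 * complex.Re (z * (w^*)%C).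
Proof. by rewrite !sqr_cabs_Re; case: z => a b; case: w => c d /=; ring. Qed.

(** Expanding the square leaves, beside the diagonal, twice the real parts of the pairwise
    products. *)
Lemma sum_sqr_cabs_le (I : eqType) (s : seq I) (f : I -> cplx R) :
  (forall i j, i \in s -> j \in s -> 0 <= complex.Re (f i * ((f j)^*)%C)) ->
  \sum_(i <- s) cabs (f i) ^+ 2 <= cabs (\sum_(i <- s) f i) ^+ 2.
Proof.
elim: s => [|i s IH] H; first by rewrite !big_nil sqr_ge0.
rewrite !big_cons sqr_cabsD -[X in X <= _]addr0 lerD //.
  rewrite lerD2l; apply: IH => j k js ks.
  by apply: H; rewrite inE (js, ks) orbT.
rewrite mulr_ge0 // conj_sum mulr_sumr raddf_sum /= big_seq sumr_ge0 // => j js.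
by apply: H; rewrite inE ?eqxx // js orbT.
Qed.

Lemma sum_weighted_sqr_cabs_le (p n : nat) (c : nat -> nat -> cplx R) (v : nat -> R) :
  args_within_right_angle p c -> (1 <= n)%N -> (forall k, 0 <= v k) ->
  \sum_(1 <= k < p.+1) v k ^+ 2 * cabs (c n k) ^+ 2 <=
  cabs (\sum_(1 <= k < p.+1) (v k)%:C%C * c n k) ^+ 2.
Proof.
move=> hc n1 v0.
have -> : \sum_(1 <= k < p.+1) v k ^+ 2 * cabs (c n k) ^+ 2 =
    \sum_(1 <= k < p.+1) cabs ((v k)%:C%C * c n k) ^+ 2.
  by apply: eq_bigr => k _; rewrite cabsM exprMn cabs_real real_normK ?num_real.
apply: sum_sqr_cabs_le => i j; rewrite !mem_index_iota => hi hj.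
have := args_within_right_angle_Re hc n1 hi hj.
have -> : (v i)%:C%C * c n i * (((v j)%:C%C * c n j)^*)%C
    = (v i * v j)%:C%C * (c n i * ((c n j)^*)%C).
  by rewrite conjM conj_real (rmorphM (real_complex R)); ring.
case: (_ * ((c n j)^*)%C) => x y /= x0.
by rewrite mul0r subr0 !mulr_ge0.
Qed.

End AcuteCoefficients.

(** * Pointwise consequence of ellipticity *)

Section EllipticBound.
Variable R : realType.
Implicit Types (z w : cplx R) (f : cplx R -> cplx R).

Lemma unit_disk_open z : unit_disk z -> \forall w \near z, unit_disk w.
Proof.
move=> z1; apply/nbhs_cabsP; exists (1 - cabs z); first by rewrite subr_gt0.
move=> w wz; have := ler_cabsD (w - z) z; rewrite subrK => h.
by apply: (le_lt_trans h); rewrite -ltrBrDr.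
Qed.

Lemma open_box_planar_measure_gt0 (x y e : R) : 0 < e ->
  (0 < planar_measure
    ([set` `](x - e)%R, (x + e)%R[] `*` [set` `](y - e)%R, (y + e)%R[]))%E.
Proof.
move=> e0; rewrite /planar_measure product_measure1E //.
have len (t : R) : lebesgue_measure [set` `](t - e)%R, (t + e)%R[] = (2 * e)%:E.
  rewrite lebesgue_measure_itv /= lte_fin ifT; last by lra.
  by rewrite -EFinB; congr EFin; ring.
rewrite [X in (_ < X * _)%E](len x) [X in (_ < _ * X)%E](len y).
by rewrite -EFinM lte_fin !mulr_gt0.
Qed.

(* The complement of a null set meets every open box. *)
Lemma ae_on_disk_all (P : cplx R -> Prop) :
  (forall z, unit_disk z -> ~ P z -> \forall w \near z, ~ P w) ->
  ae_on_disk P -> forall z, unit_disk z -> P z.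
Proof.
move=> Popen [N [mN N0 PN]] z z1; apply: contrapT => nPz.
have : \forall w \near z, unit_disk w /\ ~ P w.
  by apply: filterI; [exact: unit_disk_open | exact: Popen].
move=> /nbhs_cabsP[e e0 eP].
have e2 : 0 < e / 2 by rewrite divr_gt0.
set B := [set` `]complex.Re z - e / 2, complex.Re z + e / 2[]
     `*` [set` `]complex.Im z - e / 2, complex.Im z + e / 2[].
have BN : B `<=` N.
  move=> [x y] [/=]; rewrite !in_itv /= => /andP[x1 x2] /andP[y1 y2].
  apply: PN => /= H; have [] : unit_disk (toC (x, y)) /\ ~ P (toC (x, y)).
    apply: eP; apply: le_lt_trans (cabs_le_ReIm _) _.
    rewrite [e]splitr (raddfB (@complex.Re R)) (raddfB (@complex.Im R)) /=.
    by apply: ltrD; rewrite ltr_norml; apply/andP; split; lra.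
  by move=> h; apply; exact: H.
have := open_box_planar_measure_gt0 (complex.Re z) (complex.Im z) e2.
rewrite -/B ltNge -N0 => /negP; apply; apply: le_measure => //; rewrite inE //.
by apply: measurableX; exact: measurable_itv.
Qed.

Lemma continuous_cabs_dz f z :
  {for z, continuous (pdx f)} -> {for z, continuous (pdy f)} ->
  {for z, continuous (fun w => cabs (dz f w))} /\
  {for z, continuous (fun w => cabs (dzbar f w))}.
Proof.
move=> cx cy.
(* [dz] and [dzbar] differ only in the unit factor [s], which is [- 'i] or ['i]. *)
have key (s : cplx R) : cabs s = 1 ->
    {for z, continuous (fun w => cabs ((pdx f w + s * pdy f w) / 2))}.
  move=> s1 A /nbhs_ballP[e /= e0 eA].
  have near_pd (g : cplx R -> cplx R) : {for z, continuous g} ->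
      \forall w \near z, cabs (g w - g z) < e.
    move=> cg; apply: (cg (fun y => cabs (y - g z) < e)).
    by apply/nbhs_cabsP; exists e.
  apply: filterS (filterI (near_pd _ cx) (near_pd _ cy)) => w [wx wy]; apply: eA.
  rewrite /ball /=; apply: le_lt_trans (ler_cabs_dist _ _) _; rewrite cabsB.
  rewrite [X in cabs X](_ : _ =
    ((pdx f w - pdx f z) + s * (pdy f w - pdy f z)) * 2^-1); last by ring.
  rewrite cabsM cabsV cabs_nat ltr_pdivrMr //.
  apply: le_lt_trans (ler_cabsD _ _) _; rewrite cabsM s1 mul1r.
  by rewrite mulr_natr mulr2n; exact: (ltrD wx wy).
have i1 : cabs ('i%C : cplx R) = 1.
  by rewrite cabsE /= expr0n add0r expr1n sqrtr1.
split; last exact: key.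
have -> : (fun w => cabs (dz f w)) = fun w => cabs ((pdx f w + - 'i%C * pdy f w) / 2).
  by apply/funext => w; rewrite /dz mulNr.
by apply: key; rewrite cabsN.
Qed.

(** Violation of the elliptic inequality is an open condition; [u] and [v] stand for the moduli of
    the two Wirtinger derivatives. *)
Lemma near_elliptic_gt (T : topologicalType) (u v : T -> R) (t : T) (K K' : R) :
  {for t, continuous u} -> {for t, continuous v} ->
  K * (u t ^+ 2 - v t ^+ 2) + K' < (u t + v t) ^+ 2 ->
  \forall s \near t, K * (u s ^+ 2 - v s ^+ 2) + K' < (u s + v s) ^+ 2.
Proof.
move=> cu cv ht.
have cG : (fun s => (u s + v s) * (u s + v s)
     - (K * (u s * u s - v s * v s) + K')) @ t -->
    (u t + v t) * (u t + v t) - (K * (u t * u t - v t * v t) + K').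
  apply: cvgB; first by apply: cvgM; apply: cvgD.
  apply: cvgD; last exact: cvg_cst.
  by apply: cvgM; [exact: cvg_cst | apply: cvgB; apply: cvgM].
have : 0 < (u t + v t) * (u t + v t) - (K * (u t * u t - v t * v t) + K').
  by rewrite subr_gt0 -!expr2.
move=> /(cvgr_gt _ cG); apply: filterS => s.
by rewrite subr_gt0 -!expr2.
Qed.

Lemma elliptic_pointwise (K K' : R) f :
  continuous_on_disk (pdx f) -> continuous_on_disk (pdy f) ->
  elliptic K K' f -> forall z, unit_disk z ->
  big_Lambda f z ^+ 2 <= K * Jdet f z + K'.
Proof.
move=> cx cy [_ _ _ _ H]; apply: ae_on_disk_all H => z z1 /negP.
rewrite -ltNge => hz.
have [c1 c2] := continuous_cabs_dz (cx z z1) (cy z z1).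
by apply: filterS (near_elliptic_gt c1 c2 hz) => w hw; apply/negP; rewrite -ltNge.
Qed.

Lemma elliptic_gradient_bound (K K' lambda : R) f z : 0 <= K -> 0 <= K' ->
  unit_disk z -> sense_preserving f ->
  big_Lambda f z ^+ 2 <= K * Jdet f z + K' -> small_lambda f z <= lambda ->
  cabs (dz f z) ^+ 2 + cabs (dzbar f z) ^+ 2 <=
  ((K ^+ 2 + 1) * lambda ^+ 2 + 2 * K * Num.sqrt K' * lambda + K') / 2.
Proof.
move=> K0 K'0 z1 /(_ z z1); rewrite /big_Lambda /Jdet /small_lambda.
have := cabs_ge0 (dz f z); have := cabs_ge0 (dzbar f z).
move: (cabs (dz f z)) (cabs (dzbar f z)) => A B B0 A0; rewrite subr_ge0.
(* A nonnegative Jacobian gives [B <= A], so [small_lambda] is [A - B] and the Jacobian factors as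
   [L * s]. *)
rewrite ler_pXn2r ?nnegrE // => BA; rewrite ger0_norm ?subr_ge0 //.
have k0 := sqrtr_ge0 K'; have := sqr_sqrtr K'0.
move: (Num.sqrt K') k0 => k k0 <- H sl.
pose L := A + B; pose s := A - B.
have s0 : 0 <= s by rewrite subr_ge0.
have L0 : 0 <= L by rewrite addr_ge0.
have l0 : 0 <= lambda by apply: le_trans sl.
have HL : L ^+ 2 <= K * lambda * L + k ^+ 2.
  apply: le_trans H _; rewrite lerD2r.
  have -> : K * (A ^+ 2 - B ^+ 2) = K * L * s by rewrite /L /s; ring.
  have -> : K * lambda * L = K * L * lambda by ring.
  by rewrite ler_wpM2l // mulr_ge0.
have Kl0 : 0 <= K * lambda by rewrite mulr_ge0.
(* Otherwise [L] and [L - K * lambda] both exceed [k], and their product exceeds [k ^+ 2], against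
   [HL]. *)
have Lle : L <= K * lambda + k.
  rewrite leNgt; apply/negP => Lgt.
  have h1 : k < L - K * lambda by lra.
  have h2 : k < L by lra.
  by have := ltr_pM k0 k0 h2 h1; lra.
have L2 : L ^+ 2 <= (K * lambda + k) ^+ 2.
  by rewrite ler_pXn2r ?nnegrE // addr_ge0.
have s2 : s ^+ 2 <= lambda ^+ 2 by rewrite ler_pXn2r ?nnegrE.
have -> : A ^+ 2 + B ^+ 2 = (L ^+ 2 + s ^+ 2) / 2 by rewrite /L /s; field.
by rewrite ler_pM2r ?invr_gt0 //; lra.
Qed.

End EllipticBound.

(** * Fourier series of the derivatives *)

Section UniformApproximation.
Variable R : realType.
Implicit Types (r e : R) (f g : cplx R -> cplx R) (T : nat -> cplx R -> cplx R).

(** Uniformity is needed because the nodes in [trig_bessel] change with the truncation order. *)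
Definition uniform_on_circle r f T := forall e, 0 < e ->
  exists L0, forall L z, (L0 <= L)%N -> cabs z = r -> cabs (f z - T L z) <= e.

Lemma uniform_pser (c : nat -> cplx R) r : pseries1_analytic c -> 0 <= r < 1 ->
  uniform_on_circle r (pser c) (psum c).
Proof. by move=> hc hr e e0; exact: pser_uniform. Qed.

Lemma uniform_conj r f T : uniform_on_circle r f T ->
  uniform_on_circle r (fun z => ((f z)^*)%C) (fun L z => ((T L z)^*)%C).
Proof.
move=> H e /H[L0 HL]; exists L0 => L z /HL h /h.
by rewrite -cabs_conj (rmorphB conjc).
Qed.

Lemma uniformD r f g T T' : uniform_on_circle r f T -> uniform_on_circle r g T' ->
  uniform_on_circle r (fun z => f z + g z) (fun L z => T L z + T' L z).
Proof.
move=> H H' e e0; have e2 : 0 < e / 2 by rewrite divr_gt0.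
have [L1 h1] := H _ e2; have [L2 h2] := H' _ e2.
exists (maxn L1 L2) => L z; rewrite geq_max => /andP[l1 l2] zr.
rewrite opprD addrACA [e]splitr; apply: le_trans (ler_cabsD _ _) _.
by apply: lerD; [exact: h1 | exact: h2].
Qed.

Lemma uniformMl r (c : cplx R) f T : uniform_on_circle r f T ->
  uniform_on_circle r (fun z => c * f z) (fun L z => c * T L z).
Proof.
move=> H e e0; have c1 : 0 < cabs c + 1 by rewrite ltr_wpDl ?cabs_ge0.
have [L0 h] := H _ (divr_gt0 e0 c1).
exists L0 => L z lL zr; rewrite -mulrBr cabsM.
have := h L z lL zr; rewrite ler_pdivlMr // => h'.
have := cabs_ge0 (f z - T L z); have := cabs_ge0 c; nra.
Qed.

Lemma uniform_eq r f g T : (forall z, cabs z = r -> f z = g z) ->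
  uniform_on_circle r f T -> uniform_on_circle r g T.
Proof.
by move=> fg H e /H[L0 h]; exists L0 => L z l zr; rewrite -fg //; exact: h.
Qed.

Lemma uniform_sum (I : eqType) (s : seq I) r (f : I -> cplx R -> cplx R)
    (T : I -> nat -> cplx R -> cplx R) :
  (forall i, i \in s -> uniform_on_circle r (f i) (T i)) ->
  uniform_on_circle r (fun z => \sum_(i <- s) f i z)
    (fun L z => \sum_(i <- s) T i L z).
Proof.
elim: s => [|i s IH] H e e0.
  by exists 0%N => L z _ _; rewrite !big_nil subrr cabs0 ltW.
have [|L0 h] := uniformD (H i (mem_head _ _)) (IH _) e0.
  by move=> j js; apply: H; rewrite inE js orbT.
by exists L0 => L z l zr; rewrite !big_cons; exact: h.
Qed.

End UniformApproximation.

(** * Fourier coefficients of the Wirtinger derivatives and Bessel's inequality on circles *)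

Section PolyharmonicSeries.
Variables (R : realType) (p : nat).
Implicit Types (z : cplx R) (a b : nat -> nat -> cplx R) (r : R).

(* [z F_z] for the map [F] with coefficients [a], [b]; since [conj F] has the
   coefficients [b], [a], [zbar F_zbar] is the conjugate of [zdz_series b a]. *)
Definition zdz_series a b z : cplx R :=
  \sum_(1 <= k < p.+1) `|z| ^+ (2 * (k - 1)) *
    ((k - 1)%:R * (pser (a ^~ k) z + ((pser (b ^~ k) z)^*)%C)
     + pser (fun n => n%:R * a n k) z).

Lemma series_form_euler_diff (F : cplx R -> cplx R) (a0 : cplx R) a b z :
  has_series_form p a0 a b F -> unit_disk z ->
  euler_diff F z (zdz_series a b z) ((zdz_series b a z)^*)%C.
Proof.
move=> [hab hF] z1.
(* [G] splits the limit of mixed partial sums into a power series and a conjugated one, so that the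
   product rule applies to each term. *)
pose G w : cplx R := a0 + \sum_(1 <= k < p.+1) `|w| ^+ (2 * (k - 1)) *
  (pser (a ^~ k) w + ((pser (b ^~ k) w)^*)%C).
apply: (@euler_diff_disk _ _ G) => //.
  move=> w w1; rewrite hF // /G; congr (_ + _).
  rewrite !big_nat; apply: eq_bigr => k /hab[ha hb]; congr (_ * _).
  apply: cvgn_lim.
  have -> : (fun N : nat => \sum_(1 <= n < N) (a n k * w ^+ n + ((b n k * w ^+ n)^*)%C))
      = fun N => psum (a ^~ k) N w + ((psum (b ^~ k) N w)^*)%C.
    by apply/funext => N; rewrite big_split /= /psum conj_sum.
  exact: (cvgnD (cvg_pser ha w1) (cvg_conj (cvg_pser hb w1))).
pose al k : cplx R := `|z| ^+ (2 * (k - 1)) *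
    ((k - 1)%:R * (pser (a ^~ k) z + ((pser (b ^~ k) z)^*)%C)
     + pser (fun n => n%:R * a n k) z).
pose be k : cplx R := `|z| ^+ (2 * (k - 1)) *
    ((k - 1)%:R * (pser (a ^~ k) z + ((pser (b ^~ k) z)^*)%C)
     + ((pser (fun n => n%:R * b n k) z)^*)%C).
apply: euler_diff_eq (euler_diffD (euler_diff_cst a0 z)
  (@euler_diff_sum _ _ (index_iota 1 p.+1) _ z al be _)) _ _.
- move=> k; rewrite mem_index_iota => /hab[ha hb].
  have Ea := euler_diff_pser ha z1.
  have Eb := euler_diff_conj (euler_diff_pser hb z1).
  apply: euler_diff_eq (euler_diffM (euler_diff_normX z (k - 1))
    (euler_diffD Ea Eb)) _ _; rewrite /al /be ?conj0; ring.
- by rewrite add0r.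
rewrite add0r /zdz_series conj_sum; apply: eq_bigr => k _.
have cn : (`|z|^*)%C = `|z| :> cplx R by rewrite normr_cplx conj_real.
have ck : ((k - 1)%:R^*)%C = (k - 1)%:R :> cplx R by exact: conjc_nat.
rewrite /be conjM conjX cn conjD conjM ck conjD conjcK.
by rewrite [pser (a ^~ k) z + _]addrC.
Qed.

(* Fourier coefficients of [zdz_series a b] on the circle of radius [r]. *)
Definition pos_coef a r n : cplx R :=
  \sum_(1 <= k < p.+1) (r ^+ (n + 2 * (k - 1)) * (n + k - 1)%:R)%:C%C * a n k.

Definition neg_coef b r n : cplx R :=
  ((\sum_(1 <= k < p.+1) (r ^+ (n + 2 * (k - 1)) * (k - 1)%:R)%:C%C * b n k)^*)%C.

(** On the circle the powers of the modulus are constants, so only the power series are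
    truncated. *)
Lemma zdz_series_uniform a b r :
  (forall k : nat, (1 <= k <= p)%N ->
    pseries1_analytic (a ^~ k) /\ pseries1_analytic (b ^~ k)) ->
  0 <= r < 1 ->
  uniform_on_circle r (zdz_series a b) (fun L z => \sum_(1 <= k < p.+1)
    (r%:C%C ^+ (2 * (k - 1))) *
    ((k - 1)%:R * (psum (a ^~ k) L z + ((psum (b ^~ k) L z)^*)%C)
     + psum (fun n => n%:R * a n k) L z)).
Proof.
move=> hab r01.
apply: (@uniform_eq _ _ (fun z => \sum_(1 <= k < p.+1)
    (r%:C%C ^+ (2 * (k - 1))) *
    ((k - 1)%:R * (pser (a ^~ k) z + ((pser (b ^~ k) z)^*)%C)
     + pser (fun n => n%:R * a n k) z))).
  by move=> z zr; apply: eq_bigr => k _; rewrite normr_cplx zr.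
apply: uniform_sum => k; rewrite mem_index_iota => /hab[ha hb].
have ua := uniform_pser ha r01; have ub := uniform_conj (uniform_pser hb r01).
have uda := uniform_pser (pseries1_analyticMn ha) r01.
exact: (uniformMl _ (uniformD (uniformMl _ (uniformD ua ub)) uda)).
Qed.

(** Collecting by frequency: [+n] receives [k - 1] from the power of the modulus and [n] from the
    power series, [-n] only the former. *)
Lemma psum_trig a b r L x :
  \sum_(1 <= k < p.+1) (r%:C%C ^+ (2 * (k - 1))) *
    ((k - 1)%:R * (psum (a ^~ k) L (r%:C%C * x) + ((psum (b ^~ k) L (r%:C%C * x))^*)%C)
     + psum (fun n => n%:R * a n k) L (r%:C%C * x))
  = trig (pos_coef a r) (neg_coef b r) L x :> cplx R.
Proof.
rewrite /trig /psum.
transitivity (\sum_(1 <= k < p.+1) \sum_(1 <= n < L)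
  ((r ^+ (n + 2 * (k - 1)) * (n + k - 1)%:R)%:C%C * a n k * x ^+ n +
   (((r ^+ (n + 2 * (k - 1)) * (k - 1)%:R)%:C%C * b n k)^*)%C * (x^*)%C ^+ n) : cplx R).
  rewrite !big_nat; apply: eq_bigr => k /andP[k1 _].
  rewrite conj_sum -big_split /= mulr_sumr -big_split /= mulr_sumr.
  apply: eq_bigr => n _.
  rewrite !conjM conjX !conj_real conjM conj_real exprMn.
  rewrite -addnBA // !(rmorphM (real_complex R)) !rmorph_nat rmorphXn natrD exprD.
  rewrite exprMn; ring.
rewrite exchange_big /=; apply: eq_bigr => n _.
by rewrite big_split /= /pos_coef /neg_coef conj_sum !mulr_suml.
Qed.

Lemma zdz_series_bessel a b r (C : R) (L : nat) :
  (forall k : nat, (1 <= k <= p)%N ->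
    pseries1_analytic (a ^~ k) /\ pseries1_analytic (b ^~ k)) ->
  0 <= r < 1 ->
  (forall z, cabs z = r ->
    cabs (zdz_series a b z) ^+ 2 + cabs (zdz_series b a z) ^+ 2 <= C) ->
  \sum_(1 <= n < L) (cabs (pos_coef a r n) ^+ 2 + cabs (neg_coef b r n) ^+ 2)
  + \sum_(1 <= n < L) (cabs (pos_coef b r n) ^+ 2 + cabs (neg_coef a r n) ^+ 2)
  <= C.
Proof.
move=> hab r01 hC.
have hba k : (1 <= k <= p)%N ->
    pseries1_analytic (b ^~ k) /\ pseries1_analytic (a ^~ k).
  by move=> /hab[].
have C0 : 0 <= C.
  apply: le_trans (hC (r%:C%C) _); first by rewrite addr_ge0 ?sqr_ge0.
  by rewrite cabs_real ger0_norm //; case/andP: r01.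
apply/ler_addgt0Pr => e e0.
(* Errors of size [d] raise [s^2 + s'^2] by at most [2 d (s + s') + 2 d^2]; as [2 s + 2 s' <= 2 + C]
   and [d <= 1], this is below [d (4 + 2 C)], hence at most [e]. *)
pose d : R := Num.min 1 (e / (4 + 2 * C)).
have D0 : 0 < 4 + 2 * C by lra.
have d0 : 0 < d by rewrite lt_min ltr01 divr_gt0.
have d1 : d <= 1 by rewrite ge_min lexx.
have de : d * (4 + 2 * C) <= e by rewrite -ler_pdivlMr // ge_min lexx orbT.
have [L1 h1] := zdz_series_uniform hab r01 d0.
have [L2 h2] := zdz_series_uniform hba r01 d0.
pose M := maxn L (maxn L1 L2).
have LM : (L <= M)%N by rewrite leq_maxl.
have [LM1 LM2] : (L1 <= M)%N /\ (L2 <= M)%N.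
  by rewrite /M !leq_max !leqnn !orbT.
(* The terms are nonnegative, so the fixed order [L] may be raised to an order [M] at which the
   truncation error is small. *)
have mono (f : nat -> R) : (forall n, 0 <= f n) ->
    \sum_(1 <= n < L) f n <= \sum_(1 <= n < M) f n.
  move=> f0; rewrite -(sum_nat_cut f LM); apply: ler_sum => n _.
  by case: ifP.
apply: (@le_trans _ _ (\sum_(1 <= n < M) (cabs (pos_coef a r n) ^+ 2 + cabs (neg_coef b r n) ^+ 2)
  + \sum_(1 <= n < M) (cabs (pos_coef b r n) ^+ 2 + cabs (neg_coef a r n) ^+ 2))).
  by apply: lerD; apply: mono => n; rewrite addr_ge0 ?sqr_ge0.
apply: trig_bessel => x x1; rewrite -!psum_trig.
set z : cplx R := r%:C%C * x.
have zr : cabs z = r.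
  by rewrite cabsM x1 mulr1 cabs_real ger0_norm //; case/andP: r01.
have := h1 M z LM1 zr; have := h2 M z LM2 zr; have := hC z zr.
move: (zdz_series a b z) (zdz_series b a z) (\sum_(_ <= _ < _) _) => S S' T'.
move: (\sum_(_ <= _ < _) _) => T hS hT' hT.
have := ler_cabsD S (T - S); have := ler_cabsD S' (T' - S').
rewrite ![_ + (_ - _)]addrC !subrK !(cabsB T) !(cabsB T').
have := cabs_ge0 S; have := cabs_ge0 S'; have := cabs_ge0 T; have := cabs_ge0 T'.
move: (cabs S) (cabs S') (cabs T) (cabs T') (cabs (S - T)) (cabs (S' - T')) hS hT hT'.
move=> s s' t t' u u' hS hu hu' t'0 t0 s'0 s0 h' h.
have t2 : t ^+ 2 <= (s + d) ^+ 2 by rewrite ler_pXn2r ?nnegrE //; lra.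
have t'2 : t' ^+ 2 <= (s' + d) ^+ 2 by rewrite ler_pXn2r ?nnegrE //; lra.
have dd : d ^+ 2 <= d by rewrite expr2 ler_piMr // ltW.
have ss : 2 * s + 2 * s' <= 2 + C.
  by have := sqr_ge0 (s - 1); have := sqr_ge0 (s' - 1); nra.
have : d * (2 * s + 2 * s') <= d * (2 + C) by rewrite ler_wpM2l // ltW.
have : 0 <= d * C by rewrite mulr_ge0 // ltW.
nra.
Qed.

(** Each of [a] and [b] enters once with factor [n + k - 1] and once with [k - 1], whence the sum of
    the two squares as weight. *)
Lemma coef_lower_bound a b r n :
  args_within_right_angle p a -> args_within_right_angle p b -> (1 <= n)%N ->
  0 <= r ->
  \sum_(1 <= k < p.+1) (r ^+ (n + 2 * (k - 1))) ^+ 2 *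
     (((n + k - 1) ^ 2 + (k - 1) ^ 2)%N%:R * (cabs (a n k) ^+ 2 + cabs (b n k) ^+ 2))
  <= (cabs (pos_coef a r n) ^+ 2 + cabs (neg_coef b r n) ^+ 2)
   + (cabs (pos_coef b r n) ^+ 2 + cabs (neg_coef a r n) ^+ 2).
Proof.
move=> ha hb n1 r0.
have v0 (m : nat -> nat) k : 0 <= r ^+ (n + 2 * (k - 1)) * (m k)%:R.
  by rewrite mulr_ge0 ?exprn_ge0.
have h1 := sum_weighted_sqr_cabs_le ha n1 (v0 (fun k => n + k - 1)%N).
have h2 := sum_weighted_sqr_cabs_le hb n1 (v0 (fun k => k - 1)%N).
have h3 := sum_weighted_sqr_cabs_le hb n1 (v0 (fun k => n + k - 1)%N).
have h4 := sum_weighted_sqr_cabs_le ha n1 (v0 (fun k => k - 1)%N).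
rewrite /neg_coef !cabs_conj; apply: le_trans (lerD (lerD h1 h2) (lerD h3 h4)).
rewrite -!big_split /=; apply: ler_sum => k _.
by rewrite natrD !natrX le_eqVlt; apply/orP; left; apply/eqP; ring.
Qed.

End PolyharmonicSeries.

(** * Passage to the unit circle and the coefficient estimates *)

Section AreaInequality.
Variable R : realType.

Lemma bernoulli_1B (d : R) n : 0 <= d <= 1 -> 1 - n%:R * d <= (1 - d) ^+ n.
Proof.
move=> /andP[d0 d1]; elim: n => [|n IH]; first by rewrite mul0r subr0 expr0.
rewrite exprS; have h : 0 <= 1 - d by lra.
apply: le_trans (ler_wpM2l h IH); rewrite -natr1.
have : 0 <= n%:R * d * d by rewrite !mulr_ge0.
by lra.
Qed.

(** The limit [r] to 1 is made explicit: Bernoulli's inequality at [r = 1 - d] loses at most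
    [n * d * S <= e]. *)
Lemma le_of_expr_scaled (S C : R) (n : nat) : 0 <= S ->
  (forall r, 0 < r < 1 -> r ^+ n * S <= C) -> S <= C.
Proof.
move=> S0 H; apply/ler_addgt0Pr => e e0.
have nS : 0 <= n%:R * S by rewrite mulr_ge0.
have D0 : 0 < n%:R * S + e + 1 by lra.
pose d := e / (n%:R * S + e + 1).
have d0 : 0 < d by rewrite divr_gt0.
have d1 : d < 1 by rewrite ltr_pdivrMr // mul1r; lra.
have hd : d * (n%:R * S) <= e.
  by rewrite mulrAC ler_pdivrMr //; nra.
have hr : 0 < 1 - d < 1 by apply/andP; split; lra.
have d01 : 0 <= d <= 1 by rewrite !ltW.
apply: le_trans (_ : (1 - d) ^+ n * S + e <= _); last by rewrite lerD2r; exact: H.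
have := ler_wpM2r S0 (bernoulli_1B n d01); lra.
Qed.

Variables (K K' lambda : R) (p : nat) (F : cplx R -> cplx R) (a0 : cplx R).
Variables (a b : nat -> nat -> cplx R).
Hypotheses (hK : 1 <= K) (hK' : 0 <= K') (hp : (1 <= p)%N).
Hypotheses (F_elliptic : elliptic K K' F) (F_polyharmonic : polyharmonic p F).
Hypothesis F_series : has_series_form p a0 a b F.
Hypotheses (arg_a : args_within_right_angle p a) (arg_b : args_within_right_angle p b).
Hypothesis lambda_F : forall z : cplx R, unit_disk z -> small_lambda F z <= lambda.

Let M := (K ^+ 2 + 1) * lambda ^+ 2 + 2 * K * Num.sqrt K' * lambda + K'.

Let wt n k : R :=
  ((n + k - 1) ^ 2 + (k - 1) ^ 2)%N%:R * (cabs (a n k) ^+ 2 + cabs (b n k) ^+ 2).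

Lemma wt_ge0 n k : 0 <= wt n k.
Proof. by rewrite mulr_ge0 ?addr_ge0 ?sqr_ge0. Qed.

Lemma gradient_bound z : unit_disk z ->
  cabs (dz F z) ^+ 2 + cabs (dzbar F z) ^+ 2 <= M / 2.
Proof.
move=> z1; have [_ Fsp _ _ _] := F_elliptic.
have [CF _] := F_polyharmonic.
have [cx cy] : continuous_on_disk (pdx F) /\ continuous_on_disk (pdy F).
  (* Since [p >= 1], the order [2 * p] is at least 2, and [Cm_on_disk] supplies continuity of both
     first partial derivatives. *)
  by case: (p) hp CF => [//|q _]; rewrite mulnS add2n => -[_ _ [cx _ _ _] [cy _ _ _]].
have K0 : 0 <= K by apply: le_trans hK.
exact: (elliptic_gradient_bound K0 hK' z1 Fsp
  (elliptic_pointwise cx cy F_elliptic z1) (lambda_F z1)).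
Qed.

(** The two series have [r] times the moduli of the Wirtinger derivatives, and [r < 1]; [0 < r]
    permits division by [z]. *)
Lemma zdz_series_bound r z : 0 < r < 1 -> cabs z = r ->
  cabs (zdz_series p a b z) ^+ 2 + cabs (zdz_series p b a z) ^+ 2 <= M / 2.
Proof.
move=> /andP[r0 r1] zr.
have z1 : unit_disk z by rewrite /unit_disk /= zr.
have z0 : z != 0 by rewrite -cabs_eq0 zr gt_eqF.
have zc0 : (z^*)%C != 0 :> cplx R by rewrite conjc_eq0.
have [e1 e2] := euler_diff_dz z0 (series_form_euler_diff F_series z1).
have -> : zdz_series p a b z = dz F z * z by rewrite e1 divfK.
rewrite -[X in _ + X ^+ 2]cabs_conj.
have -> : ((zdz_series p b a z)^*)%C = dzbar F z * (z^*)%C by rewrite e2 divfK.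
rewrite (cabsM (dz F z)) (cabsM (dzbar F z)) cabs_conj zr !exprMn -mulrDl.
apply: le_trans (gradient_bound z1); rewrite ler_piMr ?addr_ge0 ?sqr_ge0 //.
by rewrite expr_le1 // ltW.
Qed.

Lemma partial_area_bound (L : nat) :
  \sum_(1 <= n < L) \sum_(1 <= k < p.+1) wt n k <= M / 2.
Proof.
have [hab _] := F_series.
(* This exponent dominates [2 * (n + 2 * (k - 1))] for all [n < L] and [k <= p], so one power of [r]
   bounds all the factors from below. *)
apply: (@le_of_expr_scaled _ _ (2 * (L + 2 * p))).
  by apply: sumr_ge0 => n _; apply: sumr_ge0 => k _; exact: wt_ge0.
move=> r r01; have r01' : 0 <= r < 1 by case/andP: r01 => /ltW -> ->.
have /andP[r0 r1] := r01'.
apply: le_trans (zdz_series_bessel L hab r01' (fun z => zdz_series_bound r01)).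
rewrite mulr_sumr -big_split /= !big_nat; apply: ler_sum => n /andP[n1 nL].
apply: le_trans (coef_lower_bound arg_a arg_b n1 r0).
rewrite mulr_sumr !big_nat; apply: ler_sum => k /andP[k1 kp].
apply: ler_wpM2r; first exact: wt_ge0.
by rewrite -exprM; apply: ler_wiXn2l => //; [exact: ltW | lia].
Qed.

Lemma wt_bound n k : (1 <= n)%N -> (1 <= k <= p)%N -> wt n k <= M / 2.
Proof.
move=> n1 k1; apply: le_trans (partial_area_bound n.+1).
rewrite (bigD1_seq n) ?iota_uniq ?mem_index_iota ?n1 ?leqnn //=.
rewrite (bigD1_seq k) ?iota_uniq ?mem_index_iota ?k1 //= -addrA lerDl.
rewrite addr_ge0 ?sumr_ge0 // => [i _|i _]; first exact: wt_ge0.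
by apply: sumr_ge0 => j _; exact: wt_ge0.
Qed.

(** The factor 2 in [(x + y)^2 <= 2 (x^2 + y^2)] cancels the one in [M / 2]. *)
Lemma coef_bound (c : R) n k : (1 <= n)%N -> (1 <= k <= p)%N -> 0 < c ->
  c ^+ 2 <= ((n + k - 1) ^ 2 + (k - 1) ^ 2)%N%:R ->
  cabs (a n k) + cabs (b n k) <= Num.sqrt M / c.
Proof.
move=> n1 k1 c0 hc; have := wt_bound n1 k1; rewrite /wt.
have := cabs_ge0 (a n k); have := cabs_ge0 (b n k).
move: (cabs (a n k)) (cabs (b n k)) (_%:R) hc => x y w hc y0 x0 hM.
have h : ((x + y) * c) ^+ 2 <= M.
  have h1 : c ^+ 2 * (x ^+ 2 + y ^+ 2) <= M / 2.
    by apply: le_trans hM; rewrite ler_wpM2r // addr_ge0 ?sqr_ge0.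
  have h2 : (x + y) ^+ 2 <= 2 * (x ^+ 2 + y ^+ 2) by have := sqr_ge0 (x - y); lra.
  have := ler_wpM2l (sqr_ge0 c) h2; rewrite exprMn; lra.
rewrite ler_pdivlMr // -[X in X <= _]ger0_norm ?mulr_ge0 ?addr_ge0 ?(ltW c0) //.
by rewrite -sqrtr_sqr ler_wsqrtr.
Qed.

(** Nonnegativity permits exchanging the finite sum over [k] with the series over [n], whose partial
    sums are already bounded. *)
Lemma area_bound :
  (\sum_(1 <= k < p.+1) \sum_(1 <= n <oo) (wt n k)%:E <= (M / 2)%:E)%E.
Proof.
have w0 k n : (0 <= (wt n k)%:E)%E by rewrite lee_fin wt_ge0.
rewrite -(nneseries_sum_nat 1 p.+1 1 w0); apply: lime_le.
  by apply: is_cvg_nneseries => n _ _; apply: sume_ge0 => k _; exact: w0.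
apply: nearW => L; under eq_bigr do rewrite sumEFin.
by rewrite sumEFin lee_fin partial_area_bound.
Qed.

End AreaInequality.

Theorem theorem2p3 (R : realType) (K K' : R) (p : nat) (F : cplx R -> cplx R)
    (a0 : cplx R) (a b : nat -> nat -> cplx R) (lambda : R)
    (hK : 1 <= K) (hK' : 0 <= K') (hp : (1 <= p)%N)
    (F_elliptic : elliptic K K' F)
    (F_polyharmonic : polyharmonic p F)
    (F_series : has_series_form p a0 a b F)
    (arg_a : args_within_right_angle p a)
    (arg_b : args_within_right_angle p b)
    (lambda_F : forall z : cplx R, unit_disk z -> small_lambda F z <= lambda) :
  let M := (K ^+ 2 + 1) * lambda ^+ 2 + 2 * K * Num.sqrt K' * lambda + K' in
  [/\ (\sum_(1 <= k < p.+1) \sum_(1 <= n <oo)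
         ((((n + k - 1) ^ 2 + (k - 1) ^ 2)%N%:R
            * (cabs (a n k) ^+ 2 + cabs (b n k) ^+ 2))%R)%:E
       <= (M / 2)%:E)%E,
      forall n : nat, (2 <= n)%N ->
        cabs (a n 1%N) + cabs (b n 1%N) <= Num.sqrt M / n%:R,
      forall n k : nat, (2 <= n)%N -> (2 <= k <= p)%N ->
        cabs (a n k) + cabs (b n k) <= Num.sqrt M / Num.sqrt 10
    & forall k : nat, (2 <= k <= p)%N ->
        cabs (a 1%N k) + cabs (b 1%N k) <= Num.sqrt M / Num.sqrt 5].
Proof.
move=> M; split.
- exact: (area_bound hK hK' hp F_elliptic F_polyharmonic F_series arg_a arg_b lambda_F).
- move=> n n2; apply: (coef_bound hK hK' hp F_elliptic F_polyharmonic F_series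
    arg_a arg_b lambda_F) => //; first by lia.
  by rewrite ltr0n; lia.
  (* For [k = 1] the weight is exactly [n ^ 2]. *)
  by rewrite addnK subnn exp0n // addn0 natrX.
- move=> n k n2 /andP[k2 kp].
  have n1 : (1 <= n)%N by lia.
  have k1 : (1 <= k <= p)%N by rewrite kp andbT; lia.
  have c0 : 0 < Num.sqrt 10 :> R by rewrite sqrtr_gt0.
  apply: (coef_bound hK hK' hp F_elliptic F_polyharmonic F_series
    arg_a arg_b lambda_F n1 k1 c0).
  rewrite sqr_sqrtr // ler_nat.
  (* Here [n + k - 1 >= 3] and [k - 1 >= 1], and [9 + 1 = 10]. *)
  have : (3 ^ 2 <= (n + k - 1) ^ 2)%N by rewrite leq_exp2r //; lia.
  have : (1 ^ 2 <= (k - 1) ^ 2)%N by rewrite leq_exp2r //; lia.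
  by lia.
- move=> k /andP[k2 kp].
  have k1 : (1 <= k <= p)%N by rewrite kp andbT; lia.
  have c0 : 0 < Num.sqrt 5 :> R by rewrite sqrtr_gt0.
  apply: (coef_bound hK hK' hp F_elliptic F_polyharmonic F_series
    arg_a arg_b lambda_F (ltn0Sn 0) k1 c0).
  rewrite sqr_sqrtr // ler_nat.
  (* With [n = 1] the first base is only at least 2, and [4 + 1 = 5]. *)
  have : (2 ^ 2 <= (1 + k - 1) ^ 2)%N by rewrite leq_exp2r //; lia.
  have : (1 ^ 2 <= (k - 1) ^ 2)%N by rewrite leq_exp2r //; lia.
  by lia.
Qed.
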